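(* In the setting of the context, let $\widehat\zeta\neq\zeta$ be an approximation to $\zeta$. Assume that the series $\beta_0:=-\sum_{n=0}^\infty\bar P_n\varphi_n$ and $\sigma^2:=2\sum_{n=0}^\infty\lambda_np_n\varphi_n^2$ converge, and put $\beta_n:=\beta_0+\sum_{j=0}^{n-1}\varphi_j$ for $n\ge 1$. Let $\widetilde\beta_{0,N}:=-\sum_{n=0}^{N-1}\bar P_n\widetilde\varphi_n^N$ and $\widetilde\sigma_N^2:=2\sum_{n=0}^{N-1}\lambda_np_n(\widetilde\varphi_n^N)^2$, with errors $E_{\mathrm{abs}}(\widetilde\beta_{0,N}):=\widetilde\beta_{0,N}-\beta_0$ and $E_{\mathrm{abs}}(\widetilde\sigma_N^2):=\widetilde\sigma_N^2-\sigma^2$. Suppose that $T_{p0}<\infty$. Then: (a) if $\lambda_Np_NT_{N0}\,E_{\mathrm{abs}}(\widehat\varphi_N^N)\to 0$ as $N\to\infty$, then $E_{\mathrm{abs}}(\widetilde\beta_{0,N})\to(T_{p0}-T_{m0})\,E_{\mathrm{abs}}(\widehat\zeta)$ as $N\to\infty$; (b) if $\lambda_Np_NT_{N0}\,E_{\mathrm{abs}}(\widehat\varphi_N^N)\to 0$, $\lambda_Np_NH_{N0}\,E_{\mathrm{abs}}(\widehat\varphi_N^N)\to 0$ and $\lambda_Np_N\sqrt{T_{0N}}\,E_{\mathrm{abs}}(\widehat\varphi_N^N)\to 0$ as $N\to\infty$, then $$E_{\mathrm{abs}}(\widetilde\sigma_N^2)\to 4\beta_m\,E_{\mathrm{abs}}(\widehat\zeta)+2\,(T_{p0}+T_{0m}-T_{m0})\,\big(E_{\mathrm{abs}}(\widehat\zeta)\big)^2\quad\text{as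 }N\to\infty.$$
   Context: Let $\{X(t)\}_{t\ge 0}$ be a continuous-time birth--death Markov chain on $\mathbb{N}_0=\{0,1,2,\dots\}$ with birth rates $\lambda_n>0$ ($n\ge 0$), death rates $\mu_n>0$ ($n\ge 1$) and $\mu_0=0$. Set $\pi_0=1$, $\pi_n=\frac{\lambda_0\cdots\lambda_{n-1}}{\mu_1\cdots\mu_n}$ for $n\ge1$. Standing assumption: $\sum_{n\ge 0} 1/(\lambda_n\pi_n)=\infty$ and $\sum_{n\ge 0}\pi_n<\infty$ (the process is uniquely determined by its rates and ergodic). The steady-state probabilities are $p_n=\pi_n/\sum_{j\ge 0}\pi_j$. Cost rates $c_n\in\mathbb{R}$ satisfy $\sum_n |c_n|p_n<\infty$, and $\zeta:=\sum_n c_np_n$. $P_n:=\sum_{j=0}^n p_j$, $\bar P_n:=1-P_n$, and $m:=\min\{n\ge 0:\bar P_n/P_n<1\}$. With $\tau_n:=\min\{t\ge 0: X(t)=n\}$ and $\mathbb{E}_n$ the expectation given $X(0)=n$: $T_{0n}:=\mathbb{E}_0[\tau_n]$, $T_{n0}:=\mathbb{E}_n[\tau_0]$ (so $T_{00}=0$), $H_{n0}:=\mathbb{E}_n[\int_0^{\tau_0}c_{X(s)}\,ds]$, and $T_{p0}:=\sum_{n\ge 1}p_nT_{n0}$ (mean first-passage time to $0$ from steady state). For $z\in\mathbb{R}$ let $f_0(z)=\frac{z-c_0}{\lambda_0}$, $f_n(z)=\frac{z-c_n}{\lambda_n}+\frac{\mu_n}{\lambda_n}f_{n-1}(z)$,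 $n\ge 1$. Exact marginal relative costs: $\varphi_n:=f_n(\zeta)$. Forward recurrence: $\widehat\varphi_n:=f_n(\widehat\zeta)$. Backward recurrence: for each $N$, given a terminal value $\widehat\varphi_N^N\in\mathbb{R}$ approximating $\varphi_N$, $\widehat\varphi_{n-1}^N=\frac{c_n-\widehat\zeta}{\mu_n}+\frac{\lambda_n}{\mu_n}\widehat\varphi_n^N$ for $n=N,\dots,1$. Mixed scheme, for $n<N$: $\widetilde\varphi_n^N:=\widehat\varphi_n$ if $P_n\le\bar P_n$ (equivalently $n<m$), $\widetilde\varphi_n^N:=\widehat\varphi_n^N$ otherwise. $E_{\mathrm{abs}}(\widehat\varphi_N^N):=\widehat\varphi_N^N-\varphi_N$, $E_{\mathrm{abs}}(\widehat\zeta):=\widehat\zeta-\zeta$. *)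

(* Defs.v *)
From HB Require Import structures.
From mathcomp Require Import all_boot all_order all_algebra.
From mathcomp Require Import all_classical all_reals all_analysis.
Set Implicit Arguments.
Unset Strict Implicit.
Unset Printing Implicit Defensive.
Import Order.TTheory GRing.Theory Num.Theory.
Import numFieldNormedType.Exports.
Local Open Scope classical_set_scope.
Local Open Scope ring_scope.

Section birth_death_process.
Context (R : realType) (d : measure_display) (Omega : measurableType d).
Implicit Types (lam mu : nat -> R) (X : R -> Omega -> nat).

Definition exit_rate lam mu (n : nat) : R := lam n + mu n.

Definition jump_prob lam mu (i j : nat) : R :=
  if j == i.+1 then lam i / exit_rate lam mu i
  else if i == j.+1 then mu i / exit_rate lam mu i
  else 0.

(* [S k] is the length of the sojourn between the k-th and (k+1)-st jumps. *)
Definition jump_time (S : nat -> Omega -> R) (k : nat) (w : Omega) : R :=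
  \sum_(0 <= j < k) S j w.

(* Joint law, for the chain started at [i], of the jump chain [Y] and the
   holding times [S]: [Y] is a discrete-time Markov chain from [i] with
   transition matrix [jump_prob], and given [Y] the holding times are
   independent, [S k] being exponential with parameter [exit_rate (Y k)]. *)
Definition jump_holding_law lam mu (i : nat) (Pi : probability Omega R)
    (Y : nat -> Omega -> nat) (S : nat -> Omega -> R) : Prop :=
  forall (k : nat) (y : nat -> nat) (s : nat -> R),
    (forall j, (j <= k)%N -> 0 <= s j) ->
    Pi [set w | forall j, (j <= k)%N -> Y j w = y j /\ s j < S j w] =
    ((y 0%N == i)%:R
     * (\prod_(0 <= j < k) jump_prob lam mu (y j) (y j.+1))
     * \prod_(0 <= j < k.+1) expR (- (exit_rate lam mu (y j) * s j)))%:E.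

(* The index set of the process is [0, +oo[; the values of [X] at negative
   times are irrelevant. *)
Definition is_birth_death_from lam mu (i : nat) (Pi : probability Omega R)
    X : Prop :=
  [/\ forall t, 0 <= t -> measurable_fun setT (X t),
      forall w t, 0 <= t -> \forall u \near t^'+, X u w = X t w &
      exists (Y : nat -> Omega -> nat) (S : nat -> Omega -> R),
        [/\ forall k, measurable_fun setT (Y k),
            forall k, measurable_fun setT (S k),
            jump_holding_law lam mu i Pi Y S &
            {ae Pi, forall w,
               (forall k, 0 < S k w) /\
               (forall k t, jump_time S k w <= t < jump_time S k.+1 w ->
                  X t w = Y k w)}]].

(* First-passage time to [n], equal to +oo when [n] is never visited.  By
   right-continuity the infimum is attained when it is finite. *)
Definition hitting_time X (n : nat) (w : Omega) : \bar R :=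
  ereal_inf [set t%:E | t in [set t : R | 0 <= t /\ X t w = n]].

(* [Pr i] is the law under which the chain starts at [i], and
   [mean_hitting_time Pr X i n] is E_i[tau_n] in [0, +oo]. *)
Definition mean_hitting_time (Pr : nat -> probability Omega R) X
    (i n : nat) : \bar R :=
  (\int[Pr i]_w hitting_time X n w)%E.

Definition mean_hitting_cost (c : nat -> R)
    (Pr : nat -> probability Omega R) X (i n : nat) : \bar R :=
  (\int[Pr i]_w
     \int[@lebesgue_measure R]_(s in
         [set s : R | (0 <= s)%R /\ s%:E < hitting_time X n w])
       (c (X s w))%:E)%E.

Definition mean_hitting_time_steady (p : nat -> R)
    (Pr : nat -> probability Omega R) X (n : nat) : \bar R :=
  (\sum_(1 <= i <oo) (p i)%:E * mean_hitting_time Pr X i n)%E.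

End birth_death_process.

Section steady_state.
Context (R : realType).
Implicit Types lam mu c : nat -> R.

Definition pi_weight lam mu (n : nat) : R :=
  (\prod_(0 <= k < n) lam k) / (\prod_(0 <= k < n) mu k.+1).

Definition steady_prob lam mu (n : nat) : R :=
  pi_weight lam mu n / limn (series (pi_weight lam mu)).

Definition steady_cdf lam mu (n : nat) : R :=
  \sum_(0 <= j < n.+1) steady_prob lam mu j.

Definition steady_tail lam mu (n : nat) : R := 1 - steady_cdf lam mu n.

Definition mean_cost lam mu c : R :=
  limn (series (fun n => c n * steady_prob lam mu n)).

Fixpoint forward_rec lam mu c (z : R) (n : nat) : R :=
  match n with
  | 0 => (z - c 0%N) / lam 0%N
  | n'.+1 => (z - c n) / lam n + mu n / lam n * forward_rec lam mu c z n'
  end.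

Definition marginal_cost lam mu c (n : nat) : R :=
  forward_rec lam mu c (mean_cost lam mu c) n.

(* Indexed by the number of backward steps: [backward_steps .. N k] is the
   value at [N - k] computed from the terminal value [phiN] at [N]. *)
Fixpoint backward_steps lam mu c (z phiN : R) (N k : nat) : R :=
  match k with
  | 0 => phiN
  | k'.+1 =>
      let n := (N - k')%N in
      (c n - z) / mu n + lam n / mu n * backward_steps lam mu c z phiN N k'
  end.

(* Meaningful for [n <= N]. *)
Definition backward_rec lam mu c (z phiN : R) (N n : nat) : R :=
  backward_steps lam mu c z phiN N (N - n).

(* Meaningful for [n < N]. *)
Definition mixed_rec lam mu c (z phiN : R) (N n : nat) : R :=
  if steady_cdf lam mu n <= steady_tail lam mu n
  then forward_rec lam mu c z n
  else backward_rec lam mu c z phiN N n.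

Definition beta0_term lam mu c (n : nat) : R :=
  steady_tail lam mu n * marginal_cost lam mu c n.

Definition beta lam mu c (n : nat) : R :=
  - limn (series (beta0_term lam mu c))
  + \sum_(0 <= j < n) marginal_cost lam mu c j.

Definition sigma2_term lam mu c (n : nat) : R :=
  lam n * steady_prob lam mu n * marginal_cost lam mu c n ^+ 2.

Definition sigma2 lam mu c : R := 2 * limn (series (sigma2_term lam mu c)).

Definition beta0_mixed lam mu c (z phiN : R) (N : nat) : R :=
  - \sum_(0 <= n < N) steady_tail lam mu n * mixed_rec lam mu c z phiN N n.

Definition sigma2_mixed lam mu c (z phiN : R) (N : nat) : R :=
  2 * \sum_(0 <= n < N)
        lam n * steady_prob lam mu n * mixed_rec lam mu c z phiN N n ^+ 2.

Definition abs_error (approx exact : R) : R := approx - exact.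

End steady_state.

(* Main.v *)
Require Import Defs.
From HB Require Import structures.
From mathcomp Require Import all_boot all_order all_algebra.
From mathcomp Require Import all_classical all_reals all_analysis.
From mathcomp Require Import measurable_realfun ring lra zify.
Import Order.TTheory GRing.Theory Num.Theory.
Import numFieldNormedType.Exports.
Local Open Scope classical_set_scope.
Local Open Scope ring_scope.

(* Write q_n = lam_n p_n, e_n for the error of the mixed scheme at n, E for the
   error on zeta, and Pb_n = 1 - P_n.  Detailed balance turns the recursions into
   statements on the flux q_n e_n: it equals E P_n in the forward part and
   q_N e_N - E (Pb_n - Pb_N) in the backward part.  The errors on beta_0 and
   sigma^2 then become linear combinations of sums that are mean hitting times,
     T_(n0) = sum_(k < n) Pb_k / q_k,     T_(0n) = sum_(k < n) P_k / q_k,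
     T_(p0) = sum_k Pb_k^2 / q_k,         H_(n0) - zeta T_(n0) = sum_(k < n) phi_k,
   and of remainders killed by the hypotheses on the terminal value and by a
   Kronecker-type lemma.

   The hitting formulas come from the Green function of the jump chain killed at
   its target: the expected time spent in a state solves a flux equation, whose
   only nonnegative solution with hitting probability at most 1 is explicit
   because sum 1 / (lam_n pi_n) diverges. *)

Set Implicit Arguments.
Unset Strict Implicit.
Unset Printing Implicit Defensive.

(** * Lower integrals and exponential tails *)

Section integral_ae.
Local Open Scope ereal_scope.
Context (d : measure_display) (T : measurableType d) (R : realType).
Variable mu : {measure set T -> \bar R}.

Import HBNNSimple.

(** A simple function below [f] is almost everywhere below [g]; conversely, one below [g] cut to 0
    on the null set lies below [f] everywhere. Each supremum therefore bounds the other. *)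
Lemma ge0_ae_eq_integralr (f g : T -> \bar R) :
  (forall x, 0 <= f x) -> (forall x, 0 <= g x) -> measurable_fun setT g ->
  {ae mu, forall x, f x = g x} -> \int[mu]_x f x = \int[mu]_x g x.
Proof.
move=> f0 g0 mg [N [mN N0 fgN]].
have fg x : ~ N x -> f x = g x.
  by move=> Nx; apply: contrapT => fgx; apply: Nx; exact: fgN.
have fN h : (forall x, (h x)%:E <= f x) ->
    {ae mu, forall x, setT x -> (h x)%:E <= g x}.
  move=> hf; exists N; split=> // x /= /not_implyP [_ hgx].
  by apply: contrapT => Nx; apply: hgx; rewrite -fg.
apply/eqP; rewrite eq_le; apply/andP; split.
  rewrite ge0_integralTE//; apply: ge_ereal_sup => _ [h /= hf <-].
  rewrite -integralT_nnsfun; apply: ae_ge0_le_integral => //; last exact: fN.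
  - by move=> x _; rewrite lee_fin.
  - exact/measurable_EFinP.
have -> : \int[mu]_x g x = \int[mu]_x (g \_ (~` N)) x.
  rewrite -integral_mkcond.
  by rewrite (ge0_negligible_integral _ _ _ _ N0)// setTD.
rewrite !ge0_integralTE//; last by move=> x; exact: erestrict_ge0.
apply: ereal_sup_le => _ [h /= hg <-]; exists h => //= x.
apply: le_trans (hg x) _; rewrite patchE; case: ifPn => // /set_mem Nx.
by rewrite fg.
Qed.

(* [f] need not be measurable: the integral of a nonnegative function is
   defined as a supremum over the simple functions below it. *)
Lemma ae_eq_integralr (f g : T -> \bar R) :
  measurable_fun setT g -> {ae mu, forall x, f x = g x} ->
  \int[mu]_x f x = \int[mu]_x g x.
Proof.
move=> mg fg; rewrite integralE [RHS]integralE; congr (_ - _);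
  apply: ge0_ae_eq_integralr => //.
- exact: measurable_funepos.
- by apply: filterS fg => x; rewrite !funeposE => ->.
- exact: measurable_funeneg.
- by apply: filterS fg => x; rewrite !funenegE => ->.
Qed.

End integral_ae.

Section exponential_tail.
Local Open Scope ereal_scope.
Context (d : measure_display) (T : measurableType d) (R : realType).
Variable P : probability T R.

(** Layer-cake formula: the tail is [a / r] times the exponential density of parameter [r], which
    integrates to 1. *)
Lemma ge0_integral_exponential_tail (f : T -> R) (a r : R) :
  measurable_fun setT f -> (forall x, 0 <= f x)%R -> (0 <= a)%R -> (0 < r)%R ->
  (forall s, (0 <= s)%R -> P [set x | (s < f x)%R] = (a * expR (- (r * s)))%:E) ->
  \int[P]_x (f x)%:E = (a / r)%:E.
Proof.
move=> mf f0 a0 r0 fE.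
pose Xm : {mfun T >-> R} := HB.pack f (isMeasurableFun.Build _ _ _ _ f mf).
have := @ge0_expectation_ccdf _ _ _ P Xm f0; rewrite unlock /= => ->.
transitivity (\int[lebesgue_measure]_(s in `[0%R, +oo[)
    ((a / r)%:E * (exponential_pdf r s)%:E)).
  apply: eq_integral => s; rewrite inE/= in_itv/= andbT => s0.
  rewrite /ccdf /distribution /pushforward.
  transitivity (P [set x | (s < f x)%R]).
    by congr (P _); apply/seteqP; split=> x /=; rewrite in_itv/= andbT.
  rewrite fE// exponential_pdfE// -EFinM; congr EFin.
  by rewrite mulNr mulrA divfK// gt_eqF.
rewrite ge0_integralZl//; last 3 first.
- apply/measurable_EFinP; apply: measurable_funTS.
  exact: measurable_exponential_pdf.
- by move=> s _; rewrite lee_fin exponential_pdf_ge0// ltW.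
- by rewrite lee_fin divr_ge0// ltW.
rewrite integral_mkcond (_ : _ \_ _ = EFin \o exponential_pdf r).
  by rewrite integral_exponential_pdf// mule1.
apply/funext => s /=; rewrite patchE; case: ifPn => //.
by rewrite notin_setE/= in_itv/= andbT => /negP; rewrite -ltNge => /lt0_exponential_pdf ->.
Qed.

End exponential_tail.

(** * The jump chain killed at its target *)

Section killed_chain.
Context (R : realType).
Implicit Types lam mu : nat -> R.

(* Law at step [l], restricted to the event that the jump chain started at [i]
   has not visited [b] strictly before [l]. *)
Fixpoint killed_prob lam mu (b i l y : nat) : R :=
  if l is l'.+1 then
    \sum_(0 <= x < y.+2 | x != b) killed_prob lam mu b i l' x * jump_prob lam mu x y
  else (y == i)%:R.

Lemma jump_prob_ge0 lam mu (lam_gt0 : forall n, 0 < lam n)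
  (mu_ge0 : forall n, 0 <= mu n) x y : 0 <= jump_prob lam mu x y.
Proof.
have r0 n : 0 <= exit_rate lam mu n by rewrite /exit_rate addr_ge0// ltW.
by rewrite /jump_prob; case: ifP => _; [|case: ifP => _ //]; rewrite divr_ge0// ltW.
Qed.

Lemma killed_prob_ge0 lam mu (lam_gt0 : forall n, 0 < lam n)
  (mu_ge0 : forall n, 0 <= mu n) b i l y : 0 <= killed_prob lam mu b i l y.
Proof.
elim: l y => [|l ih] y /=; first by rewrite ler0n.
by apply: sumr_ge0 => x _; rewrite mulr_ge0// jump_prob_ge0.
Qed.

(** Jumps have size one, so cutting the sum in [killed_prob] at [y.+2] loses no predecessor of
    [y]. *)
Lemma jump_prob_far lam mu x y : (y.+2 <= x)%N -> jump_prob lam mu x y = 0.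
Proof.
move=> yx; rewrite /jump_prob; case: eqP => [|_]; first lia.
by case: eqP => // ?; lia.
Qed.

End killed_chain.

(** * Occupation times before the target, from the joint law of jumps and holding times *)

Section jump_chain.
Context (R : realType) (d : measure_display) (Omega : measurableType d).
Variables (lam mu : nat -> R) (i : nat) (P : probability Omega R).
Variables (Y : nat -> Omega -> nat) (S : nat -> Omega -> R).
Hypothesis lam_gt0 : forall n, 0 < lam n.
Hypothesis mu_ge0 : forall n, 0 <= mu n.
Hypothesis mY : forall k, measurable_fun setT (Y k).
Hypothesis mS : forall k, measurable_fun setT (S k).
Hypothesis law : jump_holding_law lam mu i P Y S.
Variable b : nat.

Local Notation a := (killed_prob lam mu b i).
Local Notation r := (exit_rate lam mu).

(** Interpolates between a cylinder of [jump_holding_law] ([l = 0]) and the event of being at [y k]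
    at step [k] with no earlier visit to [b] ([l = k]). *)
Definition prefix_event (l k : nat) (y : nat -> nat) (s : R) : set Omega :=
  [set w | [/\ forall j, (j < l)%N -> Y j w != b,
               forall j, (l <= j <= k)%N -> Y j w = y j,
               forall j, (j < k)%N -> 0 < S j w & s < S k w]].

Lemma measurable_prefix_event l k y s : measurable (prefix_event l k y s).
Proof.
have mYA j (A : set nat) : measurable [set w | A (Y j w)].
  by rewrite -[X in measurable X]setTI; exact: (mY j).
have mSA j x : measurable [set w | x < S j w].
  rewrite -[X in measurable X]setTI.
  have := mS j measurableT (measurable_itv `]x, +oo[); congr (measurable (_ `&` _)).
  by apply/seteqP; split => w /=; rewrite in_itv/= andbT.
have mall (A : nat -> set Omega) : (forall j, measurable (A j)) ->
    measurable [set w | forall j, A j w].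
  move=> mA; rewrite [X in measurable X](_ : _ = \bigcap_j A j).
    exact: bigcapT_measurable.
  by apply/seteqP; split => w /= Aw => [j _|j]; exact: Aw.
have mimp (Q : bool) (A : set Omega) : measurable A -> measurable [set w | Q -> A w].
  case: Q => mA; first by rewrite [X in measurable X](_ : _ = A)//; apply/seteqP; split=> w /=; [exact|].
  by rewrite [X in measurable X](_ : _ = setT)//; apply/seteqP; split.
rewrite [X in measurable X](_ : _ = [set w | forall j, (j < l)%N -> Y j w != b] `&`
   [set w | forall j, (l <= j <= k)%N -> Y j w = y j] `&`
   [set w | forall j, (j < k)%N -> 0 < S j w] `&` [set w | s < S k w]).
  apply: measurableI => //; apply: measurableI; first apply: measurableI;
    apply: (mall (fun j => [set w | _ -> _])) => j; apply: (mimp _ [set w | _]).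
  - exact: (mYA j [set x | x != b]).
  - exact: (mYA j [set y j]).
  - exact: mSA.
by apply/seteqP; split => w /=; [case | move=> [[[? ?] ?] ?]].
Qed.

(* Induction on [l]: freeing the coordinate [Y l] sums the law over its
   values different from [b], which is one step of the killed chain. *)
Lemma prefix_event_prob l k y s : (l <= k)%N -> 0 <= s ->
  P (prefix_event l k y s) =
  (a l (y l) * (\prod_(l <= j < k) jump_prob lam mu (y j) (y j.+1))
   * expR (- (r (y k) * s)))%:E.
Proof.
move=> lk s0; elim: l lk y => [_ y|l ih lk y].
  (* Threshold 0 for all holding times but the last makes their exponential factors equal to 1. *)
  have := @law k y (fun j => if j == k then s else 0).
  rewrite (_ : [set w | _] = prefix_event 0 k y s).
    move=> -> => [|j _]; last by case: eqP.
    rewrite /= big_nat_recr//= eqxx; congr ((_ * _ * _)%:E).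
    rewrite big_nat_cond big1 ?mul1r// => j; rewrite andbT => /andP[_ jk].
    by rewrite (ltn_eqF jk) mulr0 oppr0 expR0.
  apply/seteqP; split => w /= => [yS|[_ yE S0 Sk] j jk].
    split=> // [j /yS[]//|j jk|].
      by have [_] := yS j (ltnW jk); rewrite (ltn_eqF jk).
    by have [_] := yS k (leqnn k); rewrite eqxx.
  split; first by rewrite yE.
  by case: eqP => [->//|/eqP jk']; apply: S0; rewrite ltn_neqAle jk'.
pose yx x j := if j == l then x else y j.
have -> : prefix_event l.+1 k y s =
    \bigcup_(x in [set x | x != b]) prefix_event l k (yx x) s.
  apply/seteqP; split => w.
    move=> [Yb Yy S0 Sk]; exists (Y l w); first exact: Yb.
    split=> // j; first by move=> jl; apply: Yb; rewrite ltnS ltnW.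
    rewrite /yx; case: eqP => [->//|/eqP jl] /andP[lj jk].
    by apply: Yy; rewrite jk andbT ltn_neqAle eq_sym jl.
  move=> [x /= xb [Yb Yy S0 Sk]].
  have Yl : Y l w = x by rewrite Yy /yx ?eqxx// leqnn ltnW.
  split=> // j.
    rewrite ltnS leq_eqVlt => /predU1P[->|]; first by rewrite Yl.
    exact: Yb.
  move=> /andP[lj jk]; rewrite Yy /yx ?gtn_eqF// jk andbT; exact: ltnW.
rewrite measure_bigcup; last 2 first.
- by move=> x _; exact: measurable_prefix_event.
- apply/trivIsetP => x z _ _ xz; apply/seteqP; split => // w [[_ Yx _ _] [_ Yz _ _]].
  move: xz; have := Yx l; have := Yz l; rewrite /yx eqxx leqnn ltnW// => -> // -> //.
  by rewrite eqxx.
set C := (\prod_(l.+1 <= j < k) jump_prob lam mu (y j) (y j.+1))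
   * expR (- (r (y k) * s)).
have Px x : P (prefix_event l k (yx x) s) =
    (a l x * jump_prob lam mu x (y l.+1) * C)%:E.
  rewrite ih 1?ltnW// {1}/yx eqxx big_ltn// {1 2}/yx eqxx gtn_eqF// /C.
  rewrite [yx x k]/yx gtn_eqF// !mulrA; congr ((_ * _ * _)%:E).
  apply: eq_big_nat => j /andP[lj _].
  by rewrite /yx !gtn_eqF// ltnS ltnW.
(* States from [(y l.+1).+2] on cannot jump to [y l.+1], which leaves the finite sum defining
   [killed_prob]. *)
rewrite eseries_mkcond (nneseries_split 0 (y l.+1).+2); last first.
  by move=> x _; case: ifP => // _; rewrite measure_ge0.
rewrite [X in (_ + X)%E]eseries0 ?adde0; last first.
  move=> x xy _; case: ifP => // _.
  by apply: (etrans (Px x)); rewrite jump_prob_far// mulr0 mul0r.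
rewrite add0n -big_mkcond/= -mulrA -/C mulr_suml -sumEFin.
apply: eq_big => [x|x _]; last exact: Px.
by apply/idP/idP; rewrite inE.
Qed.

Definition at_before (k j : nat) (s : R) := prefix_event k k (fun=> j) s.

Lemma at_before_prob k j s : 0 <= s ->
  P (at_before k j s) = (a k j * expR (- (r j * s)))%:E.
Proof. by move=> s0; rewrite prefix_event_prob// big_geq// mulr1. Qed.

Lemma exit_rate_gt0 j : 0 < r j.
Proof. by apply: (lt_le_trans (lam_gt0 j)); rewrite lerDl. Qed.

(** [at_before k j 0] includes the condition [0 < S k w], so the value is nonnegative for every [w],
    not only almost surely. *)
Definition sojourn (k j : nat) (w : Omega) : R := S k w * \1_(at_before k j 0) w.

Lemma sojourn_ge0 k j w : 0 <= sojourn k j w.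
Proof.
rewrite /sojourn indicE; case: (boolP (w \in _)) => /=.
  by rewrite inE => -[_ _ _ Sk]; rewrite mulr1 ltW.
by rewrite mulr0.
Qed.

Lemma measurable_sojourn k j : measurable_fun setT (sojourn k j).
Proof.
apply: measurable_funM => //; apply: measurable_indic.
exact: measurable_prefix_event.
Qed.

Lemma integral_sojourn k j :
  (\int[P]_w (sojourn k j w)%:E = (a k j / r j)%:E)%E.
Proof.
apply: ge0_integral_exponential_tail.
- exact: measurable_sojourn.
- exact: sojourn_ge0.
- by rewrite killed_prob_ge0.
- exact: exit_rate_gt0.
move=> s s0; rewrite -at_before_prob//; congr (P _).
apply/seteqP; split => w /=; rewrite /sojourn indicE.
  case: (boolP (w \in _)) => /=; last by rewrite mulr0 ltNge s0.
  by rewrite inE mulr1 => -[].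
move=> [Yb Yj S0 Sk]; rewrite mem_set ?mulr1//.
by split => //; exact: le_lt_trans Sk.
Qed.

Lemma trivIset_at_before : trivIset setT (fun k => at_before k b 0).
Proof.
apply/trivIsetP => x z _ _; wlog xz : x z / (x < z)%N => [h|_].
  by rewrite neq_ltn => /orP[xz|zx]; [|rewrite setIC]; apply: h;
    rewrite // ?ltn_eqF // gtn_eqF.
apply/seteqP; split => // w [[_ Yx _ _] [Yz _ _ _]].
by have := Yz x xz; rewrite Yx ?leqnn// eqxx.
Qed.

(** The events [at_before k b 0] say that [b] is first visited at step [k]; they are disjoint. *)
Lemma hitting_mass_le1 n : \sum_(0 <= k < n) a k b <= 1.
Proof.
rewrite -lee_fin -sumEFin.
rewrite (eq_bigr (fun k => P (at_before k b 0))); last first.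
  by move=> k _; rewrite at_before_prob// mulr0 oppr0 expR0 mulr1.
rewrite big_mkord.
have mA k : measurable (at_before k b 0) by exact: measurable_prefix_event.
have <- : P (\big[setU/set0]_(k < n) at_before k b 0) =
    (\sum_(k < n) P (at_before k b 0))%E.
  exact: (@measure_bigsetU _ _ _ P _ mA trivIset_at_before n).
exact/probability_le1/bigsetU_measurable.
Qed.

Lemma ae_hit : (\sum_(0 <= k <oo) (a k b)%:E = 1)%E ->
  {ae P, forall w, exists2 K, Y K w = b & forall j, (j < K)%N -> Y j w != b}.
Proof.
move=> h1; have mU : measurable (\bigcup_k at_before k b 0).
  by apply: bigcup_measurable => k _; exact: measurable_prefix_event.
exists (~` \bigcup_k at_before k b 0); split.
- exact: measurableC.
- rewrite probability_setC// measure_semi_bigcup//; last 2 first.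
  - by move=> k; exact: measurable_prefix_event.
  - exact: trivIset_at_before.
  rewrite (eq_eseriesr (g := fun k => (a k b)%:E)); last first.
    move=> k _; apply: etrans (at_before_prob k b (lexx 0)) _.
    by rewrite mulr0 oppr0 expR0 mulr1.
  by rewrite h1 subee.
- apply: subsetC => w [k _ [Yb Yk _ _]]; exists k => //.
  by rewrite Yk// leqnn.
Qed.

(** Cost accumulated before reaching [b], as a series of measurable terms. It replaces the
    functionals built on [hitting_time], which agree with it almost surely once [b] is hit with
    probability 1. *)
Definition occupation_cost (f : nat -> R) (w : Omega) : \bar R :=
  (\sum_(0 <= k <oo) \sum_(0 <= j <oo | j != b) (f j * sojourn k j w)%:E)%E.

Lemma measurable_sojournZ (f : nat -> R) k j :
  measurable_fun setT (fun w => (f j * sojourn k j w)%:E).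
Proof.
apply/measurable_EFinP; apply: measurable_funM => //.
exact: measurable_sojourn.
Qed.

Lemma measurable_occupation_cost f : (forall j, 0 <= f j) ->
  measurable_fun setT (occupation_cost f).
Proof.
move=> f0; apply: ge0_emeasurable_sum => k => [w _ _|_].
  apply: nneseries_ge0 => j _ _.
  by apply: mulr_ge0; [exact: f0|exact: sojourn_ge0].
apply: ge0_emeasurable_sum => j => [w _ _|_].
  by apply: mulr_ge0; [exact: f0|exact: sojourn_ge0].
exact: measurable_sojournZ.
Qed.

Lemma integral_occupation_cost f : (forall j, 0 <= f j) ->
  (\int[P]_w occupation_cost f w =
   \sum_(0 <= j <oo | j != b) (f j)%:E * \sum_(0 <= k <oo) (a k j / r j)%:E)%E.
Proof.
move=> f0; have Z0 k j w : (0 <= (f j * sojourn k j w)%:E)%E.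
  by apply: mulr_ge0; [exact: f0|exact: sojourn_ge0].
have a0 k j : 0 <= a k j / r j.
  by rewrite divr_ge0// ?killed_prob_ge0// ltW// exit_rate_gt0.
rewrite integral_nneseries//; last 2 first.
- move=> k; apply: ge0_emeasurable_sum => // j _; exact: measurable_sojournZ.
- by move=> k w _; apply: nneseries_ge0.
transitivity (\sum_(0 <= k <oo) \sum_(0 <= j <oo)
    (if j != b then f j * (a k j / r j) else 0)%:E)%E.
  apply: eq_eseriesr => k _.
  under eq_integral do rewrite eseries_mkcond.
  rewrite integral_nneseries//; last 2 first.
  - by move=> j; case: (j != b) => //; exact: measurable_sojournZ.
  - by move=> j w _; case: (j != b).
  apply: eq_eseriesr => j _; case: (j != b); last by rewrite integral0.
  under eq_integral do rewrite EFinM.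
  rewrite ge0_integralZl//; last 3 first.
  - by apply/measurable_EFinP; exact: measurable_sojourn.
  - by move=> w _; rewrite lee_fin sojourn_ge0.
  - by rewrite lee_fin.
  by rewrite integral_sojourn EFinM.
rewrite nneseries_interchange; last first.
  by move=> k j; case: (j != b) => //; rewrite lee_fin mulr_ge0.
rewrite [RHS]eseries_mkcond; apply: eq_eseriesr => j _; case: (j != b).
  by rewrite -nneseriesZl// => k _; rewrite lee_fin.
by rewrite eseries0.
Qed.

End jump_chain.

(** * Green function of the killed chain *)

Section green_function.
Context (R : realType).
Variables lam mu : nat -> R.
Hypothesis lam_gt0 : forall n, 0 < lam n.
Hypothesis mu0 : mu 0%N = 0.
Hypothesis mu_gt0 : forall n, (1 <= n)%N -> 0 < mu n.

Lemma death_rate_ge0 n : 0 <= mu n.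
Proof. by case: n => [|n]; [rewrite mu0 | exact/ltW/mu_gt0]. Qed.

Local Notation r := (exit_rate lam mu).
Local Notation wt := (pi_weight lam mu).

Lemma pi_weight_gt0 n : 0 < wt n.
Proof. by apply: divr_gt0; apply: prodr_gt0 => k _ //; exact: mu_gt0. Qed.

Lemma pi_weightS n : mu n.+1 * wt n.+1 = lam n * wt n.
Proof.
have M0 : 0 < \prod_(0 <= k < n) mu k.+1 by apply: prodr_gt0 => k _; exact: mu_gt0.
have := mu_gt0 (ltn0Sn n) => m0; rewrite /pi_weight !big_nat_recr//=.
by field; rewrite !gt_eqF.
Qed.

Lemma lam_pi_gt0 n : 0 < lam n * wt n.
Proof. by rewrite mulr_gt0// pi_weight_gt0. Qed.

Section killed.
Variables b i : nat.
Local Notation a := (killed_prob lam mu b i).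

(** Expected number of visits to [y] in the first [n] steps of the killed chain; [V n y] is the
    expected time there, set to 0 at [b] because time stops counting on arrival. *)
Let A n y := \sum_(0 <= k < n) a k y.
Let V n y := if y == b then 0 else A n y / r y.

Let r_gt0 y : 0 < r y.
Proof. by apply: exit_rate_gt0 => //; exact: death_rate_ge0. Qed.

Let a_ge0 k y : 0 <= a k y.
Proof. by apply: killed_prob_ge0 => //; exact: death_rate_ge0. Qed.

Let A_ge0 n y : 0 <= A n y.
Proof. by apply: sumr_ge0. Qed.

Let V_ge0 n y : 0 <= V n y.
Proof. by rewrite /V; case: eqP => // _; rewrite divr_ge0// ltW. Qed.

Let A_mono y : nondecreasing_seq (A ^~ y).
Proof.
apply/nondecreasing_seqP => n.
by rewrite /A big_nat_recr//= lerDl.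
Qed.

Let AS n y : A n.+1 y =
  (y == i)%:R + \sum_(0 <= x < y.+2 | x != b) A n x * jump_prob lam mu x y.
Proof.
rewrite /A big_nat_recl//=; congr (_ + _).
rewrite exchange_big/=; apply: eq_bigr => x _.
by rewrite mulr_suml.
Qed.

Let jumpV n x y : (if x != b then A n x * jump_prob lam mu x y else 0) =
  V n x * (if y == x.+1 then lam x else if x == y.+1 then mu x else 0).
Proof.
rewrite /V; case: (x == b) => /=; first by rewrite mul0r.
have := r_gt0 x => rx; rewrite /jump_prob.
by case: ifP => _; [|case: ifP => _]; field; rewrite gt_eqF.
Qed.

Let AS0 n : A n.+1 0 = (0 == i)%:R + V n 1 * mu 1%N.
Proof.
rewrite AS big_mkcond; congr (_ + _).
by rewrite !big_nat_recr//= big_geq// !jumpV/= mulr0 !add0r.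
Qed.

Let ASS n y : A n.+1 y.+1 =
  (y.+1 == i)%:R + V n y * lam y + V n y.+2 * mu y.+2.
Proof.
rewrite AS big_mkcond -addrA; congr (_ + _).
rewrite !big_nat_recr//= big_nat_cond big1 ?add0r.
  have e1 : (y.+1 == y.+2) = false by apply/negbTE; lia.
  have e2 : (y.+1 == y.+3) = false by apply/negbTE; lia.
  by rewrite !jumpV !eqxx e1 e2 mulr0 addr0.
move=> x /andP[/andP[_ xy] _].
have e1 : (y.+1 == x.+1) = false by apply/negbTE; lia.
have e2 : (x == y.+2) = false by apply/negbTE; lia.
by rewrite jumpV e1 e2 mulr0.
Qed.

Let VA n y : y != b -> A n y = V n y * r y.
Proof. by rewrite /V => /negPf ->; rewrite divfK// gt_eqF. Qed.

Let V_le_up n y : V n y * lam y <= A n.+1 y.+1.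
Proof.
rewrite ASS addrAC lerDr addr_ge0// mulr_ge0//; exact: death_rate_ge0.
Qed.

Let V_le_down n y : V n y.+1 * mu y.+1 <= A n.+1 y.
Proof.
case: y => [|y]; first by rewrite AS0 lerDr.
by rewrite ASS lerDr addr_ge0// mulr_ge0// ltW.
Qed.

(** Finiteness of the expected number of visits. It spreads from a state to any neighbour other than
    [b], since the flow from that neighbour into the state is at most the number of visits to the
    state. *)
Let bnd y := exists M, forall n, A n y <= M.

Let bnd_up y : y != b -> bnd y.+1 -> bnd y.
Proof.
move=> yb [M AM]; exists (M / lam y * r y) => n; rewrite VA//.
apply: ler_wpM2r; first exact: ltW.
by rewrite ler_pdivlMr//; exact: le_trans (V_le_up n y) (AM _).
Qed.

Let bnd_down y : y.+1 != b -> bnd y -> bnd y.+1.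
Proof.
move=> yb [M AM]; exists (M / mu y.+1 * r y.+1) => n; rewrite VA//.
apply: ler_wpM2r; first exact: ltW.
rewrite ler_pdivlMr ?mu_gt0//; exact: le_trans (V_le_down n y) (AM _).
Qed.

Let g y := limn (A ^~ y).
Let v y := if y == b then 0 else g y / r y.

Let A_cvg y : bnd y -> A ^~ y @ \oo --> g y.
Proof.
move=> [M AM]; apply: (nondecreasing_is_cvgn (A_mono y)).
by exists M => _ [n _ <-].
Qed.

Let g_ge0 y : bnd y -> 0 <= g y.
Proof.
move=> by_; apply: limr_ge; first exact: A_cvg.
by apply: nearW.
Qed.

Let V_cvg y : bnd y -> V ^~ y @ \oo --> v y.
Proof.
move=> by_; rewrite /V /v; case: eqP => _; first exact: cvg_cst.
by apply: cvgMr_tmp; exact: A_cvg.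
Qed.

Let v_ge0 y : bnd y -> 0 <= v y.
Proof.
by move=> by_; rewrite /v; case: eqP => // _; rewrite divr_ge0 ?g_ge0// ltW.
Qed.

Let vr y : y != b -> g y = v y * r y.
Proof. by rewrite /v => /negPf ->; rewrite divfK// gt_eqF. Qed.

Let g0E : bnd 0 -> bnd 1 -> g 0 = (0 == i)%:R + v 1 * mu 1%N.
Proof.
move=> b0 b1; have h : (fun n => A n.+1 0) @ \oo --> g 0.
  by rewrite (cvg_shiftS (A ^~ 0%N)); exact: A_cvg.
rewrite -(cvg_lim (@Rhausdorff R) h); apply: cvg_lim => //.
under eq_fun do rewrite AS0.
by apply: cvgD; [exact: cvg_cst | apply: cvgMr_tmp; exact: V_cvg].
Qed.

Let gSE y : bnd y -> bnd y.+1 -> bnd y.+2 ->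
  g y.+1 = (y.+1 == i)%:R + v y * lam y + v y.+2 * mu y.+2.
Proof.
move=> b0 b1 b2; have h : (fun n => A n.+1 y.+1) @ \oo --> g y.+1.
  by rewrite (cvg_shiftS (A ^~ y.+1)); exact: A_cvg.
rewrite -(cvg_lim (@Rhausdorff R) h); apply: cvg_lim => //.
under eq_fun do rewrite ASS.
apply: cvgD; last by apply: cvgMr_tmp; exact: V_cvg.
by apply: cvgD; [exact: cvg_cst | apply: cvgMr_tmp; exact: V_cvg].
Qed.

Let eseries_v y : bnd y -> y != b ->
  (\sum_(0 <= k <oo) (a k y / r y)%:E = (v y)%:E)%E.
Proof.
move=> by_ yb; apply/cvg_lim => //.
under eq_fun do rewrite sumEFin -mulr_suml.
apply: cvg_EFin; first by apply: nearW.
by have := V_cvg by_; rewrite /V /v (negPf yb).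
Qed.

Let eseries_g y : bnd y -> (\sum_(0 <= k <oo) (a k y)%:E = (g y)%:E)%E.
Proof.
move=> by_; apply/cvg_lim => //.
under eq_fun do rewrite sumEFin.
by apply: cvg_EFin; [apply: nearW | exact: A_cvg].
Qed.

Hypothesis mass_le1 : forall n, \sum_(0 <= k < n) a k b <= 1.

Let bnd_b : bnd b. Proof. by exists 1. Qed.

Let g_b_le1 : g b <= 1.
Proof.
apply: limr_le; first exact: A_cvg.
by apply: nearW.
Qed.

(* The net flux [mu_(y+1) v_(y+1) - lam_y v_y] across [y, y+1] is the hitting
   probability [g 0] minus the source term; if [g 0] were less than 1, the
   divergence of [sum 1 / (lam_n pi_n)] would drive [v] below 0. *)
Lemma killed_green_down : b = 0%N ->
  (\sum_(0 <= n <oo) ((lam n * wt n)^-1)%:E = +oo)%E ->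
  (\sum_(0 <= k <oo) (a k b)%:E = 1)%E /\
  forall y, y != b -> (\sum_(0 <= k <oo) (a k y / r y)%:E =
    (wt y * \sum_(0 <= x < i | (x < y)%N) (lam x * wt x)^-1)%:E)%E.
Proof.
move=> b0 div; have bA y : bnd y.
  by elim: y => [|y ih]; [rewrite -b0 | apply: bnd_down; rewrite // b0].
have v0 : v 0 = 0 by rewrite /v b0.
(* Balance at [y.+1] carries the net flux from one edge to the next, with the unit source subtracted
   once [i] is passed. *)
have flux y : mu y.+1 * v y.+1 - lam y * v y = g 0 - (i <= y)%:R.
  elim: y => [|y ih]; first by rewrite g0E// v0 leqn0 eq_sym; ring.
  have := gSE (bA y) (bA y.+1) (bA y.+2); rewrite vr ?b0// /exit_rate => E.
  have -> : (i <= y.+1)%:R = (y.+1 == i)%:R + (i <= y)%:R :> R.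
    rewrite leq_eqVlt eq_sym ltnS; case: eqP => [<-|_]; last by rewrite add0r.
    by rewrite ltnn addr0.
  by rewrite -[mu y.+2 * _]mulrC; lra.
(* Dividing the flux equation by [lam y * wt y], which equals [mu y.+1 * wt y.+1], gives the
   increment of [v / wt]; hence [u] is [v / wt]. *)
pose u n := \sum_(0 <= y < n) (g 0 - (i <= y)%:R) / (lam y * wt y).
have vu n : v n = wt n * u n.
  elim: n => [|n ih]; first by rewrite v0 /u big_geq// mulr0.
  rewrite /u big_nat_recr//= -/(u n) -flux.
  have := pi_weight_gt0 n; have := pi_weight_gt0 n.+1 => w1 w0.
  have -> : lam n * wt n = mu n.+1 * wt n.+1 by rewrite pi_weightS.
  apply: (mulfI (lt0r_neq0 (mu_gt0 (ltn0Sn n)))).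
  have := pi_weightS n; rewrite ih => E.
  have -> : lam n * (wt n * u n) = mu n.+1 * wt n.+1 * u n.
    by rewrite mulrA -E.
  have := mu_gt0 (ltn0Sn n) => m1.
  by field; rewrite !gt_eqF.
have g1 : g 0 = 1.
  apply/eqP; rewrite eq_le -{1}b0 g_b_le1/= leNgt; apply/negP => g_lt1.
  pose C := \sum_(0 <= y < i) (lam y * wt y)^-1.
  have sumle n : \sum_(0 <= y < n) (lam y * wt y)^-1 <= C / (1 - g 0).
    have h0 : 0 <= u n by rewrite -(pmulr_rge0 _ (pi_weight_gt0 n)) -vu v_ge0.
    rewrite ler_pdivlMr ?subr_gt0// -subr_ge0; apply: le_trans h0 _.
    (* Adding [1 - g 0] times the partial sum leaves only the terms of index below [i], and these
       total at most [C]. *)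
    have uE : u n + (\sum_(0 <= y < n) (lam y * wt y)^-1) * (1 - g 0)
       = \sum_(0 <= y < n) (y < i)%:R * (lam y * wt y)^-1.
      rewrite mulr_suml -big_split/=; apply: eq_bigr => y _.
      rewrite ltnNge; case: (i <= y)%N => /=; lra.
    rewrite lerBrDr uE /C; have [ni|ni] := leqP n i.
      rewrite (big_cat_nat (n := n) (p := i))//=.
      rewrite -[leLHS]addr0; apply: lerD.
        apply: ler_sum_nat => y /andP[_ yn].
        by rewrite (leq_trans yn ni) mul1r.
      by apply: sumr_ge0 => y _; rewrite invr_ge0 ltW// lam_pi_gt0.
    rewrite (big_cat_nat (n := i) (p := n))//=; last exact: ltnW.
    rewrite [X in _ + X]big_nat_cond [X in _ + X]big1 ?addr0; last first.
      by move=> y /andP[/andP[iy _] _]; rewrite ltnNge iy mul0r.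
    by apply: ler_sum_nat => y /andP[_ yi]; rewrite yi mul1r.
  suff : (+oo <= (C / (1 - g 0))%:E)%E by rewrite leye_eq.
  rewrite -div; apply: lime_le.
    by apply: is_cvg_nneseries => n _ _; rewrite lee_fin invr_ge0 ltW// lam_pi_gt0.
  by apply: nearW => n; rewrite sumEFin lee_fin.
split; first by rewrite eseries_g// b0 g1.
move=> y yb; rewrite eseries_v// vu /u; congr ((_ * _)%:E).
have -> : \sum_(0 <= x < i | (x < y)%N) (lam x * wt x)^-1 =
          \sum_(0 <= x < y | (x < i)%N) (lam x * wt x)^-1.
  rewrite (big_nat_widen _ _ (maxn i y)) ?leq_maxl//.
  rewrite [RHS](big_nat_widen _ _ (maxn i y)) ?leq_maxr//.
  by apply: eq_bigl => x; rewrite andbC.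
rewrite [RHS]big_mkcond/=; apply: eq_bigr => x _; rewrite g1 ltnNge.
by case: (i <= x)%N => /=; lra.
Qed.

(** Started at 0, the chain cannot get above [b] without hitting it, so every edge below [b] carries
    net upward flux 1. Solving downwards from [v b = 0] gives the formula, and the flux on the last
    edge is the hitting probability. *)
Lemma killed_green_up : i = 0%N -> (0 < b)%N ->
  (\sum_(0 <= k <oo) (a k b)%:E = 1)%E /\
  forall y, y != b -> (\sum_(0 <= k <oo) (a k y / r y)%:E =
    (wt y * \sum_(y <= x < b) (lam x * wt x)^-1)%:E)%E.
Proof.
move=> i0 b0; have far k y : (b < y)%N -> a k y = 0.
  elim: k y => [|k ih] y by_ /=; first by rewrite i0 gtn_eqF// (leq_trans _ by_).
  rewrite big_nat_cond big1// => x /andP[/andP[_ xy] xb].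
  have [bx|] := ltnP b x; first by rewrite ih// mul0r.
  rewrite leq_eqVlt (negPf xb)/= => bx; rewrite /jump_prob.
  by rewrite !ifF ?mulr0//; apply/negbTE; lia.
have bA y : bnd y.
  have [by_|] := ltnP b y.
    by exists 0 => n; rewrite /A big1// => k _; rewrite far.
  move=> yb; have -> : y = (b - (b - y))%N by lia.
  have : (b - y <= b)%N by lia.
  elim: (b - y)%N => [|j ih] jb; first by rewrite subn0.
  by apply: bnd_up; [lia | rewrite -subSn// subSS; apply: ih; lia].
have vb : v b = 0 by rewrite /v eqxx.
have vfar y : (b < y)%N -> v y = 0.
  move=> by_; rewrite /v gtn_eqF// /g; have -> : A ^~ y = cst 0.
    by apply/funext => n; rewrite /A big1// => k _; rewrite far.
  by rewrite lim_cst// mul0r.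
have flux y : (y < b)%N -> mu y.+1 * v y.+1 - lam y * v y = -1.
  elim: y => [|y ih] yb.
    have := g0E (bA _) (bA _); rewrite i0 eqxx => E.
    have := @vr 0%N; rewrite /exit_rate mu0 (ltn_eqF b0) => /(_ isT).
    by rewrite E mulr1n addr0 mulrC => E'; rewrite [lam 0%N * _]mulrC -E'; ring.
  have := gSE (bA y) (bA y.+1) (bA y.+2).
  have := @vr y.+1; rewrite /exit_rate (ltn_eqF yb) => /(_ isT) ->.
  rewrite i0 /= => E.
  by have := ih (ltnW yb); lra.
have vE y : v y = wt y * \sum_(y <= x < b) (lam x * wt x)^-1.
  have [by_|] := ltnP b y; first by rewrite vfar// big_geq ?mulr0// ltnW.
  move=> yb; have -> : y = (b - (b - y))%N by lia.
  have : (b - y <= b)%N by lia.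
  elim: (b - y)%N => [|j ih] jb; first by rewrite subn0 big_geq// mulr0.
  set z := (b - j.+1)%N; have zb : (z < b)%N by rewrite /z; lia.
  have zS : (b - j)%N = z.+1 by rewrite /z; lia.
  have := ih (ltnW jb); rewrite zS => vz.
  have := pi_weight_gt0 z; have := lam_gt0 z => l0 w0.
  rewrite big_ltn//; set Sg := \sum_(z.+1 <= x < b) _ in vz *.
  have fz : lam z * v z = lam z * wt z * Sg + 1.
    by rewrite -pi_weightS -mulrA -vz; have := flux _ zb => fz; lra.
  apply: (mulfI (lt0r_neq0 l0)); rewrite fz.
  by field; rewrite !gt_eqF.
split; last by move=> y yb; rewrite eseries_v// vE.
rewrite eseries_g//; congr EFin.
have := gSE (bA b.-1) (bA b.-1.+1) (bA b.-1.+2).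
rewrite prednK// i0 gtn_eqF// (vfar b.+1)// => ->.
have bb : (b.-1 < b)%N by rewrite prednK.
rewrite mul0r addr0 add0r vE big_ltn// prednK// big_geq// addr0.
have := pi_weight_gt0 b.-1; have := lam_gt0 b.-1 => l0 w0.
by field; rewrite !gt_eqF.
Qed.

End killed.

End green_function.

(** * First-passage times and costs *)

Section sample_path.
Context (R : realType) (d : measure_display) (Omega : measurableType d).
Variables (X : R -> Omega -> nat) (Y : nat -> Omega -> nat) (S : nat -> Omega -> R).
Variables (b K : nat) (w : Omega).
Hypothesis S_gt0 : forall k, 0 < S k w.
Hypothesis XY : forall k t, jump_time S k w <= t < jump_time S k.+1 w -> X t w = Y k w.
Hypothesis YK : Y K w = b.
Hypothesis Yb : forall j, (j < K)%N -> Y j w != b.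

Local Notation J k := (jump_time S k w).

Let JS k : J k.+1 = J k + S k w.
Proof. by rewrite /jump_time big_nat_recr. Qed.

Let J0 : J 0 = 0. Proof. by rewrite /jump_time big_geq. Qed.

Let J_ge0 k : 0 <= J k.
Proof. by apply: sumr_ge0 => j _; exact: ltW. Qed.

Let J_lt k : J k < J k.+1.
Proof. by rewrite JS ltrDl. Qed.

(** The sojourn intervals before step [K] cover [[0, J K[], and on each of them [X] stays at a state
    other than [b]. *)
Lemma hitting_timeE : hitting_time X b w = (J K)%:E.
Proof.
have find n t : 0 <= t -> t < J n -> exists2 k, (k < n)%N & J k <= t < J k.+1.
  move=> t0; elim: n => [|n ih]; first by rewrite J0 ltNge t0.
  have [tn _|tn tn1] := ltP t (J n); last by exists n => //; rewrite tn.
  by have [k kn Jk] := ih tn; exists k => //; rewrite ltnW.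
apply/eqP; rewrite eq_le; apply/andP; split.
  apply: ereal_inf_lbound; exists (J K) => //; split=> //.
  by rewrite (XY (k := K)) ?lexx/=.
apply: le_ereal_inf_tmp => _ [t [t0 Xt] <-]; rewrite lee_fin leNgt; apply/negP => tJ.
have [k kK Jk] := find _ _ t0 tJ.
by have := Yb kK; rewrite -(XY Jk) Xt eqxx.
Qed.

Lemma hitting_costE (c : nat -> R) :
  (\int[@lebesgue_measure R]_(s in
     [set s : R | (0 <= s)%R /\ s%:E < hitting_time X b w]) (c (X s w))%:E)%E
  = (\sum_(0 <= k < K) c (Y k w) * S k w)%:E.
Proof.
rewrite hitting_timeE (_ : [set s : R | _] = `[0, J K[%classic); last first.
  by apply/seteqP; split=> s /=; rewrite in_itv/= lte_fin => /andP.
set h := fun s => (c (X s w))%:E.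
have hk k : {in `[J k, J k.+1[%classic, h =1 cst (c (Y k w))%:E}.
  by move=> s; rewrite inE/= in_itv/= => /XY; rewrite /h => ->.
(* Measurability is carried through the induction because additivity of the integral requires it. *)
suff [] : measurable_fun `[0, J K[%classic h /\
    (\int[@lebesgue_measure R]_(s in `[0%R, J K[) h s)%E
    = (\sum_(0 <= k < K) c (Y k w) * S k w)%:E by [].
elim: K => [|n [mh ih]].
  by rewrite J0 set_itvco0 integral_set0 big_geq//; split=> //; exact: measurable_fun_set0.
have UE : `[0, J n.+1[%classic = `[0, J n[%classic `|` `[J n, J n.+1[%classic :> set R.
  by rewrite -itv_bndbnd_setU// bnd_simp// ltW.
have mhn : measurable_fun `[J n, J n.+1[%classic h.
  by apply: (eq_measurable_fun (cst (c (Y n w))%:E)) => // s /hk ->.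
rewrite UE; split; first exact/measurable_funU.
rewrite integral_setU//; last 2 first.
- exact/measurable_funU.
- rewrite disj_set2E; apply/eqP/seteqP; split => // s [/=].
  by rewrite !in_itv/= => /andP[_ sJ] /andP[]; rewrite leNgt sJ.
rewrite ih (eq_integral (cst (c (Y n w))%:E)); last exact: hk.
rewrite integral_cst// [X in (_ * X)%E]lebesgue_measure_itv/= lte_fin J_lt.
by rewrite big_nat_recr//= JS -EFinD addrAC subrr add0r EFinD EFinM.
Qed.

(** For [k < K] only [j = Y k w] contributes. For [k >= K] nothing does: either the chain is at [b],
    which the inner sum excludes, or [b] was visited before. *)
Lemma occupation_costE (f : nat -> R) : (forall j, 0 <= f j) ->
  occupation_cost Y S b f w = (\sum_(0 <= k < K) f (Y k w) * S k w)%:E.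
Proof.
move=> f0; rewrite /occupation_cost (nneseries_split 0 K); last first.
  move=> k _; apply: nneseries_ge0 => j _ _.
  by apply: mulr_ge0; [exact: f0|exact: sojourn_ge0].
rewrite [X in (_ + X)%E]eseries0 ?adde0 ?add0n; last first.
  move=> k Kk _; apply: eseries0 => j _ jb.
  rewrite /sojourn indicE memNset ?mulr0//= => -[Ylt Yk _ _].
  move: Kk; rewrite leq_eqVlt => /predU1P[kE|Kk].
    by move: jb; rewrite -YK -(Yk K) ?eqxx// kE leqnn.
  by have := Ylt _ Kk; rewrite YK eqxx.
rewrite -sumEFin; apply: eq_big_nat => k /andP[_ kK].
have Zk j : sojourn Y S b k j w = if Y k w == j then S k w else 0.
  rewrite /sojourn indicE; case: eqP => [Ykj|Ykj].
    rewrite mem_set ?mulr1//; split=> [l lk|l|l _|] //.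
    - exact/Yb/(ltn_trans lk).
    - by rewrite -eqn_leq => /eqP <-.
  rewrite memNset ?mulr0// => -[_ Yk _ _].
  by apply: Ykj; rewrite Yk// leqnn.
rewrite eseries_mkcond (nneseries_split 0 (Y k w).+1); last first.
  move=> j _; case: ifP => // _.
  by apply: mulr_ge0; [exact: f0|exact: sojourn_ge0].
rewrite [X in (_ + X)%E]eseries0 ?adde0 ?add0n; last first.
  by move=> j jk _; rewrite Zk (ltn_eqF jk) mulr0; case: ifP.
rewrite big_nat_recr//= big_nat_cond big1 ?add0e; last first.
  by move=> j /andP[/andP[_ jk] _]; rewrite Zk (gtn_eqF jk) mulr0; case: ifP.
by rewrite Yb// Zk eqxx.
Qed.

End sample_path.

(** * Mean hitting times and costs as sums over the Green function *)

Section mean_hitting.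
Context (R : realType) (d : measure_display) (Omega : measurableType d).
Variables (lam mu : nat -> R) (X : R -> Omega -> nat) (Pr : nat -> probability Omega R).
Hypothesis lam_gt0 : forall n, 0 < lam n.
Hypothesis mu_ge0 : forall n, 0 <= mu n.
Variables (i b : nat).
Hypothesis bdX : is_birth_death_from lam mu i (Pr i) X.

Local Notation a := (killed_prob lam mu b i).
Local Notation r := (exit_rate lam mu).
Local Notation green j := (\sum_(0 <= k <oo) (a k j / r j)%:E)%E.

Lemma killed_mass_le1 n : \sum_(0 <= k < n) a k b <= 1.
Proof.
by have [_ _ [Y [S [mY mS law _]]]] := bdX; exact: hitting_mass_le1 mY mS law _ _.
Qed.

Hypothesis hit1 : (\sum_(0 <= k <oo) (a k b)%:E = 1)%E.

Lemma mean_hitting_timeE :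
  mean_hitting_time Pr X i b = (\sum_(0 <= j <oo | j != b) green j)%E.
Proof.
have [_ _ [Y [S [mY mS law pathX]]]] := bdX.
rewrite /mean_hitting_time (ae_eq_integralr (g := occupation_cost Y S b (fun=> 1))).
- rewrite (integral_occupation_cost lam_gt0 mu_ge0 mY mS law)//.
  by apply: eq_eseriesr => j _; rewrite mul1e.
- exact: measurable_occupation_cost.
apply: filterS2 pathX (ae_hit mY mS law hit1) => w [S0 XY] [K YK Yb].
rewrite (hitting_timeE S0 XY YK Yb) (occupation_costE S0 YK Yb)//.
by congr EFin; apply: eq_bigr => k _; rewrite mul1r.
Qed.

(** The occupation formula is for nonnegative costs, so it is applied to both parts of [c]; the
    finite values [s] and [t] make them integrable and the difference legitimate. *)
Lemma mean_hitting_costE (c : nat -> R) (s t : R) :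
  (\sum_(0 <= j <oo | j != b) (Num.max (c j) 0)%:E * green j = s%:E)%E ->
  (\sum_(0 <= j <oo | j != b) (Num.max (- c j) 0)%:E * green j = t%:E)%E ->
  mean_hitting_cost c Pr X i b = (s - t)%:E.
Proof.
move=> sE tE; have [_ _ [Y [S [mY mS law pathX]]]] := bdX.
have max0 (x : R) : 0 <= Num.max x 0 by rewrite le_max lexx orbT.
set cp := fun j => Num.max (c j) 0; set cn := fun j => Num.max (- c j) 0.
have mocc f : (forall j, 0 <= f j) -> measurable_fun setT (occupation_cost Y S b f).
  exact: measurable_occupation_cost.
have iocc f x : (forall j, 0 <= f j) ->
    (\sum_(0 <= j <oo | j != b) (f j)%:E * green j = x%:E)%E ->
    (\int[Pr i]_w occupation_cost Y S b f w = x%:E)%E.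
  by move=> f0 <-; exact: (integral_occupation_cost lam_gt0 mu_ge0 mY mS law).
have occ0 f w : (forall j, 0 <= f j) -> (0 <= occupation_cost Y S b f w)%E.
  move=> f0; apply: nneseries_ge0 => k _ _; apply: nneseries_ge0 => j _ _.
  by apply: mulr_ge0; [exact: f0|exact: sojourn_ge0].
have integ f x : (forall j, 0 <= f j) ->
    (\int[Pr i]_w occupation_cost Y S b f w = x%:E)%E ->
    (Pr i).-integrable setT (occupation_cost Y S b f).
  move=> f0 fE; apply/integrableP; split; first exact: mocc.
  under eq_integral do rewrite gee0_abs ?occ0//.
  by rewrite fE ltry.
have sI := iocc cp s (fun j => max0 _) sE.
have tI := iocc cn t (fun j => max0 _) tE.
rewrite /mean_hitting_cost (ae_eq_integralr (g :=
  occupation_cost Y S b cp \- occupation_cost Y S b cn)%E).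
- rewrite integralB//; last 2 first.
  + by apply: integ sI => j; exact: max0.
  + by apply: integ tI => j; exact: max0.
  by rewrite sI tI.
- by apply: emeasurable_funB; apply: mocc => j; exact: max0.
apply: filterS2 pathX (ae_hit mY mS law hit1) => w [S0 XY] [K YK Yb].
rewrite (hitting_costE S0 XY YK Yb) !(occupation_costE S0 YK Yb) => [|j|j]; try exact: max0.
rewrite -EFinB -sumrB; congr EFin; apply: eq_bigr => k _.
rewrite -mulrBl; congr (_ * _); rewrite /cp /cn.
by case: (leP (c (Y k w)) 0); case: (leP (- c (Y k w)) 0) => ? ?; lra.
Qed.

End mean_hitting.

(** * Errors of the mixed scheme *)

Section mixed_scheme_errors.
Context (R : realType).
Variables (p q phi : nat -> R).

Local Notation P n := (\sum_(0 <= j < n.+1) p j).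
Local Notation Pb n := (1 - P n).
Local Notation t := (series (fun n => Pb n / q n)).
Local Notation s := (series (fun n => P n / q n)).
Local Notation rho := (series (fun n => (q n)^-1)).
Local Notation W := (series (fun n => Pb n ^+ 2 / q n)).
Local Notation Phi := (series phi).

Lemma sum_lt_indic (f : nat -> R) (m N : nat) : (m <= N)%N ->
  \sum_(0 <= n < N) (n < m)%:R * f n = \sum_(0 <= n < m) f n.
Proof.
move=> mN; rewrite (big_cat_nat (n := m))//= [X in _ + X]big_nat_cond.
rewrite [X in _ + X]big1 ?addr0; last first.
  by move=> n /andP[/andP[mn _] _]; rewrite ltnNge mn mul0r.
by apply: eq_big_nat => n /andP[_ nm]; rewrite nm mul1r.
Qed.

(* A Kronecker-type lemma: [d N * U N <= d N * U M + sum_(M <= n < N) d n * u n]. *)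
Lemma kronecker_nonincreasing (f u : nat -> R) :
  (forall n, 0 <= f n) -> (forall n, 0 <= u n) -> nonincreasing_seq f ->
  f @ \oo --> 0 -> cvgn (series (fun n => f n * u n)) ->
  f N * series u N @[N --> \oo] --> 0.
Proof.
move=> f0 u0 fdec fl cvfu; apply/cvgr0Pnorm_le => e e0.
have fu0 n : 0 <= f n * u n by rewrite mulr_ge0.
set L := limn (series (fun n => f n * u n)).
have [M _ HM] : \forall M \near \oo, L - series (fun n => f n * u n) M <= e / 2.
  have /cvgrPdist_le/(_ (e / 2)) : series (fun n => f n * u n) @ \oo --> L by [].
  rewrite divr_gt0// => /(_ isT); apply: filterS => n.
  exact: le_trans (ler_norm _).
have {}HM := HM M (leqnn M).
have Lub N : series (fun n => f n * u n) N <= L.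
  apply: nondecreasing_cvgn_le => //; apply/nondecreasing_seqP => n.
  by rewrite /series/= big_nat_recr//= lerDl.
have fM : f N * series u M @[N --> \oo] --> 0.
  by rewrite -[X in _ --> X](mul0r (series u M)); apply: cvgMr_tmp.
move/cvgr0Pnorm_le/(_ (e / 2)) : fM; rewrite divr_gt0// => /(_ isT) fM.
near=> N; have MN : (M <= N)%N by near: N; exact: nbhs_infty_ge.
have US n : 0 <= series u n by apply: sumr_ge0.
rewrite ger0_norm ?mulr_ge0//.
have -> : series u N = series u M + \sum_(M <= n < N) u n.
  by rewrite /series/= (big_cat_nat (n := M)).
rewrite mulrDr [e]splitr; apply: lerD.
  apply: le_trans (ler_norm _) _; near: N; exact: fM.
apply: le_trans HM; apply: (@le_trans _ _ (\sum_(M <= n < N) f n * u n)).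
  by rewrite mulr_sumr; apply: ler_sum_nat => n /andP[_ nN];
    apply: ler_wpM2r => //; apply: fdec; exact: ltnW.
rewrite lerBrDl; apply: le_trans (Lub N).
by rewrite /series/= [leRHS](big_cat_nat (n := M)).
Unshelve. all: by end_near. Qed.

(** * Asymptotics of the tail when T_(p0) is finite *)

Hypothesis p_gt0 : forall n, 0 < p n.
Hypothesis q_gt0 : forall n, 0 < q n.
Hypothesis p_cvg : series p @ \oo --> (1 : R).
Variables (B Sg Tp : R).
Hypothesis B_cvg : series (fun n => Pb n * phi n) @ \oo --> B.
Hypothesis Sg_cvg : series (fun n => q n * phi n ^+ 2) @ \oo --> Sg.
Hypothesis Tp_cvg : \sum_(1 <= i < N) p i * t i @[N --> \oo] --> Tp.

Let Tp_cvgS : \sum_(1 <= i < N.+1) p i * t i @[N --> \oo] --> Tp.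
Proof.
by have := Tp_cvg; rewrite -(cvg_shiftS (fun N => \sum_(1 <= i < N) p i * t i)).
Qed.

Lemma tail_ge0 n : 0 <= Pb n.
Proof.
rewrite subr_ge0; have <- : limn (series p) = 1 by apply: cvg_lim.
apply: (@nondecreasing_cvgn_le _ (series p)) => //; last by apply/cvg_ex; exists 1.
by apply/nondecreasing_seqP => k; rewrite /series/= big_nat_recr//= lerDl ltW.
Qed.

Lemma tailS n : Pb n.+1 = Pb n - p n.+1.
Proof. by rewrite big_nat_recr//= opprD addrA. Qed.

Lemma tail_gt0 n : 0 < Pb n.
Proof.
apply: (@le_lt_trans _ _ (Pb n.+1)); first exact: tail_ge0.
by rewrite tailS ltrBlDr ltrDl.
Qed.

Lemma tail_nonincreasing : nonincreasing_seq (fun n => Pb n).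
Proof. by apply/nonincreasing_seqP => n; rewrite tailS lerBlDr lerDl ltW. Qed.

Lemma cdf_cvg1 : P n @[n --> \oo] --> (1 : R).
Proof. by have := p_cvg; rewrite -(cvg_shiftS (series p)). Qed.

Lemma tail_cvg0 : Pb n @[n --> \oo] --> 0.
Proof.
rewrite -[X in _ --> X](subrr 1); apply: cvgB; first exact: cvg_cst.
exact: cdf_cvg1.
Qed.

Lemma mean_down_ge0 n : 0 <= t n.
Proof. by apply: sumr_ge0 => k _; rewrite divr_ge0 ?tail_ge0// ltW. Qed.

Lemma mean_down_nondecreasing : nondecreasing_seq t.
Proof.
by apply/nondecreasing_seqP => k; rewrite /series/= big_nat_recr//= lerDl
  divr_ge0 ?tail_ge0// ltW.
Qed.

(** Summation by parts: [p n.+1] is the decrement of the tail. *)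
Lemma sum_mean_down N : \sum_(1 <= i < N.+1) p i * t i = W N - Pb N * t N.
Proof.
have series0 (u : nat -> R) : series u 0%N = 0 by rewrite /series/= big_geq.
elim: N => [|N ih]; first by rewrite big_geq// !series0 mulr0 subr0.
rewrite big_nat_recr//= ih tailS.
have -> : W N.+1 = W N + Pb N ^+ 2 / q N by rewrite /series/= big_nat_recr.
have -> : t N.+1 = t N + Pb N / q N by rewrite /series/= big_nat_recr.
by have := q_gt0 N => q0; field; rewrite gt_eqF.
Qed.

(** Since [t] is nondecreasing, the mass beyond [N] times [t N] is at most the sum of [p i * t i]
    over [i > N], a remainder of the series for [Tp]. *)
Lemma tail_mean_down_cvg0 : Pb N * t N @[N --> \oo] --> 0.
Proof.
have pt0 i : 0 <= p i * t i by rewrite mulr_ge0 ?mean_down_ge0// ltW.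
have ub N : Pb N * t N <= Tp - \sum_(1 <= i < N.+1) p i * t i.
  rewrite lerBrDr.
  have lhs : (P M - P N) * t N + \sum_(1 <= i < N.+1) p i * t i @[M --> \oo]
      --> Pb N * t N + \sum_(1 <= i < N.+1) p i * t i.
    apply: cvgD; last exact: cvg_cst.
    by apply: cvgMr_tmp; apply: cvgB; [exact: cdf_cvg1 | exact: cvg_cst].
  apply: ler_cvg_to lhs Tp_cvgS _; near=> M.
  have NM : (N <= M)%N by near: M; exact: nbhs_infty_ge.
  rewrite [leRHS](big_cat_nat (n := N.+1))//= [leRHS]addrC lerD2r.
  have -> : P M - P N = \sum_(N.+1 <= i < M.+1) p i.
    by rewrite (big_cat_nat (n := N.+1))//= addrAC subrr add0r.
  rewrite mulr_suml; apply: ler_sum_nat => i /andP[Ni _].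
  by apply: ler_wpM2l; [exact: ltW | apply: mean_down_nondecreasing; exact: ltnW].
apply: (@squeeze_cvgr _ _ _ _ (cst 0) (fun N => Tp - \sum_(1 <= i < N.+1) p i * t i)).
- by apply: nearW => N; rewrite ub mulr_ge0 ?mean_down_ge0 ?tail_ge0.
- exact: cvg_cst.
rewrite -[X in _ --> X](subrr Tp); apply: cvgB; first exact: cvg_cst.
exact: Tp_cvgS.
Unshelve. all: by end_near. Qed.

Lemma tail_sq_cvg : W @ \oo --> Tp.
Proof.
have -> : W = (fun N => \sum_(1 <= i < N.+1) p i * t i + Pb N * t N).
  by apply/funext => N; rewrite sum_mean_down subrK.
rewrite -[X in _ --> X](addr0 Tp); apply: cvgD; last exact: tail_mean_down_cvg0.
exact: Tp_cvgS.
Qed.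

Lemma tail_sq_rho_cvg0 : Pb N ^+ 2 * rho N @[N --> \oo] --> 0.
Proof.
apply: (kronecker_nonincreasing (f := fun n => Pb n ^+ 2)).
- by move=> n; exact: sqr_ge0.
- by move=> n; rewrite invr_ge0 ltW.
- move=> n k nk; rewrite ler_sqr ?nnegrE ?tail_ge0//.
  exact: tail_nonincreasing.
- by rewrite -[X in _ --> X](mulr0 0); under eq_fun do rewrite expr2; apply: cvgM; exact: tail_cvg0.
- by apply/cvg_ex; exists Tp; exact: tail_sq_cvg.
Qed.

(** The two convergent series of squares, for [Tp] and [Sg], make the tail-weighted sum of [phi]
    absolutely convergent; the Kronecker lemma then applies to [|phi|]. *)
Lemma tail_Phi_cvg0 : Pb N * Phi N @[N --> \oo] --> 0.
Proof.
have cvabs : cvgn (series (fun n => Pb n * `|phi n|)).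
  apply: (@series_le_cvg _ _ (fun n => Pb n ^+ 2 / q n + q n * phi n ^+ 2)).
  - by move=> n; rewrite mulr_ge0 ?tail_ge0.
  - move=> n; have q0 := ltW (q_gt0 n).
    by apply: addr_ge0; [apply: divr_ge0 | apply: mulr_ge0] => //; exact: sqr_ge0.
  - move=> n; have q0 := q_gt0 n; have Pb0 := tail_ge0 n.
    (* AM-GM on [Pb / sqrt q] and [sqrt q * |phi|] *)
    rewrite -[phi n ^+ 2]real_normK ?num_real//; set x := `|phi n|.
    have -> : Pb n ^+ 2 / q n + q n * x ^+ 2 = (Pb n ^+ 2 + (q n * x) ^+ 2) / q n.
      by field; rewrite gt_eqF.
    rewrite ler_pdivlMr//; have x0 : 0 <= x by exact: normr_ge0.
    have -> : Pb n * x * q n = Pb n * (q n * x) by ring.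
    have : 0 <= q n * x by rewrite mulr_ge0// ltW.
    move: Pb0 (q n * x) => + z; set y := Pb n => y0 z0.
    by have := sqr_ge0 (y - z); have := mulr_ge0 y0 z0; rewrite sqrrB; lra.
  - have -> : series (fun n => Pb n ^+ 2 / q n + q n * phi n ^+ 2) =
      (fun N => W N + series (fun n => q n * phi n ^+ 2) N).
      by apply/funext => N; rewrite /series/= big_split.
    by apply/cvg_ex; exists (Tp + Sg); apply: cvgD => //; exact: tail_sq_cvg.
have K : Pb N * series (fun n => `|phi n|) N @[N --> \oo] --> 0.
  apply: (kronecker_nonincreasing (f := fun n => Pb n)) => //.
  - exact: tail_ge0.
  - exact: tail_nonincreasing.
  - exact: tail_cvg0.
have bnd : \forall N \near \oo, 0 <= `|Pb N * Phi N| <=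
    Pb N * series (fun n => `|phi n|) N.
  apply: nearW => N; rewrite normr_ge0/= normrM (ger0_norm (tail_ge0 N)).
  by apply: ler_wpM2l; [exact: tail_ge0 | exact: ler_norm_sum].
by apply: norm_cvg0; apply: (squeeze_cvgr bnd) => //; exact: cvg_cst.
Qed.

(** * Limits of the errors on beta_0 and sigma^2 *)

Variables (m : nat) (E : R) (a : nat -> R).
Hypothesis at_cvg0 : a N * t N @[N --> \oo] --> 0.

(** The part of the backward flux error that does not depend on [n]; [a N] stands for the flux error
    at the terminal index. *)
Let h N := a N + E * Pb N.
Let e N n := (if (n < m)%N then E * P n else a N - E * (Pb n - Pb N)) / q n.

(* Both branches of the mixed scheme in one formula. *)
Let eE N n : e N n = (h N - E * Pb n + (n < m)%:R * (E - h N)) / q n.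
Proof. by rewrite /e /h; case: (n < m)%N; congr (_ / _) => /=; ring. Qed.

Lemma terminal_flux_cvg0 : a @ \oo --> 0.
Proof.
(* [t] vanishes at 0, so the lower bound on it is its value at 1, valid for [N >= 1]. *)
have t1 : 0 < t 1%N by rewrite /series/= big_nat1 divr_gt0// tail_gt0.
have bnd : \forall N \near \oo, 0 <= `|a N| <= `|a N * t N| * (t 1%N)^-1.
  near=> N; rewrite normr_ge0/= ler_pdivlMr// normrM.
  rewrite (ger0_norm (mean_down_ge0 N)); apply: ler_wpM2l => //.
  by apply: mean_down_nondecreasing; near: N; exact: nbhs_infty_ge.
apply: norm_cvg0; apply: (squeeze_cvgr bnd); first exact: cvg_cst.
rewrite -[X in _ --> X](mul0r (t 1%N)^-1); apply: cvgMr_tmp.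
by rewrite -[X in _ --> X](normr0 R); apply: cvg_norm.
Unshelve. all: by end_near. Qed.

Lemma flux_cvg0 : h @ \oo --> 0.
Proof.
rewrite -[X in _ --> X](addr0 0); apply: cvgD; first exact: terminal_flux_cvg0.
by rewrite -[X in _ --> X](mulr0 E); apply: cvgMl_tmp; exact: tail_cvg0.
Qed.

Lemma flux_mean_down_cvg0 : h N * t N @[N --> \oo] --> 0.
Proof.
have -> : (fun N => h N * t N) = (fun N => a N * t N + E * (Pb N * t N)).
  by apply/funext => N; rewrite /h mulrDl mulrA.
rewrite -[X in _ --> X](addr0 0); apply: cvgD => //.
by rewrite -[X in _ --> X](mulr0 E); apply: cvgMl_tmp; exact: tail_mean_down_cvg0.
Qed.

(** By [eE] the error splits into a remainder of the series for [B], the term [h N * t N], a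
    multiple of [W N] and a sum over [n < m]; only the last two survive. *)
Lemma beta0_mixed_error_cvg :
  - \sum_(0 <= n < N) Pb n * (phi n + e N n) + B @[N --> \oo] -->
  (Tp - t m) * E.
Proof.
have key : \forall N \near \oo,
    (B - series (fun n => Pb n * phi n) N) - h N * t N + E * W N - (E - h N) * t m
    = - \sum_(0 <= n < N) Pb n * (phi n + e N n) + B.
  near=> N; have mN : (m <= N)%N by near: N; exact: nbhs_infty_ge.
  have -> : \sum_(0 <= n < N) Pb n * (phi n + e N n) =
     \sum_(0 <= n < N) (Pb n * phi n + h N * (Pb n / q n)
       - E * (Pb n ^+ 2 / q n) + (E - h N) * ((n < m)%:R * (Pb n / q n))).
    apply: eq_bigr => n _; rewrite eE.
    by have := q_gt0 n => q0; field; rewrite gt_eqF.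
  rewrite !big_split/= sumrN -!mulr_sumr sum_lt_indic// /series/=.
  by ring.
apply: cvg_trans (near_eq_cvg key) _.
have -> : (Tp - t m) * E = (B - B) - 0 + E * Tp - (E - 0) * t m by ring.
apply: cvgB; last by apply: cvgMr_tmp; apply: cvgB; [exact: cvg_cst|exact: flux_cvg0].
apply: cvgD; last by apply: cvgMl_tmp; exact: tail_sq_cvg.
by apply: cvgB; [apply: cvgB => //; exact: cvg_cst | exact: flux_mean_down_cvg0].
Unshelve. all: by end_near. Qed.

Hypothesis aPhi_cvg0 : a N * Phi N @[N --> \oo] --> 0.
Hypothesis as_cvg0 : a N * Num.sqrt (s N) @[N --> \oo] --> 0.

(** [P n >= p 0] gives [rho N <= s N / p 0], so [as_cvg0] controls the terminal part of [h]; the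
    tail part is [tail_sq_rho_cvg0]. *)
Lemma flux_sq_rho_cvg0 : h N ^+ 2 * rho N @[N --> \oo] --> 0.
Proof.
have rho0 N : 0 <= rho N by apply: sumr_ge0 => n _; rewrite invr_ge0 ltW.
have s0 N : 0 <= s N.
  by apply: sumr_ge0 => n _; rewrite divr_ge0 ?sumr_ge0// => *; rewrite ltW.
have p0 := p_gt0 0.
have rhos N : rho N <= s N / p 0%N.
  rewrite ler_pdivlMr// mulr_suml; apply: ler_sum => n _.
  rewrite mulrC ler_wpM2r ?invr_ge0 ?(ltW (q_gt0 n))// big_nat_recl//= lerDl.
  by apply: sumr_ge0 => k _; exact: ltW.
have as2 : (a N * Num.sqrt (s N)) ^+ 2 / p 0%N @[N --> \oo] --> 0.
  rewrite [X in _ --> X](_ : 0 = 0 * 0 / p 0%N); last by rewrite !mul0r.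
  by under eq_fun do rewrite expr2; apply: cvgMr_tmp; apply: cvgM.
have bnd : \forall N \near \oo, 0 <= h N ^+ 2 * rho N <=
    2 * ((a N * Num.sqrt (s N)) ^+ 2 / p 0%N) + 2 * E ^+ 2 * (Pb N ^+ 2 * rho N).
  apply: nearW => N; rewrite mulr_ge0 ?sqr_ge0//=.
  rewrite exprMn sqr_sqrtr//; apply: (@le_trans _ _
    (2 * (a N ^+ 2 * rho N) + 2 * E ^+ 2 * (Pb N ^+ 2 * rho N))).
    have -> : 2 * (a N ^+ 2 * rho N) + 2 * E ^+ 2 * (Pb N ^+ 2 * rho N) =
      (2 * a N ^+ 2 + 2 * (E * Pb N) ^+ 2) * rho N by ring.
    apply: ler_wpM2r => //; rewrite /h; set x := E * _.
    by have := sqr_ge0 (a N - x); nra.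
  rewrite lerD2r ler_pM2l// -[leRHS]mulrA.
  by apply: ler_wpM2l => //; exact: sqr_ge0.
apply: (squeeze_cvgr bnd); first exact: cvg_cst.
rewrite -[X in _ --> X](addr0 0); apply: cvgD.
  by rewrite -[X in _ --> X](mulr0 2); apply: cvgMl_tmp.
by rewrite -[X in _ --> X](mulr0 (2 * E ^+ 2)); apply: cvgMl_tmp; exact: tail_sq_rho_cvg0.
Qed.

Lemma flux_Phi_cvg0 : h N * Phi N @[N --> \oo] --> 0.
Proof.
have -> : (fun N => h N * Phi N) = (fun N => a N * Phi N + E * (Pb N * Phi N)).
  by apply/funext => N; rewrite /h mulrDl mulrA.
rewrite -[X in _ --> X](addr0 0); apply: cvgD => //.
by rewrite -[X in _ --> X](mulr0 E); apply: cvgMl_tmp; exact: tail_Phi_cvg0.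
Qed.

(** In the limit, the cross term of the square gives the contribution linear in [E], and the squared
    error gives the quadratic one. *)
Lemma sigma2_mixed_error_cvg :
  2 * (\sum_(0 <= n < N) q n * (phi n + e N n) ^+ 2) - 2 * Sg @[N --> \oo] -->
  4 * (- B + Phi m) * E + 2 * (Tp + s m - t m) * E ^+ 2.
Proof.
pose sig := series (fun n => q n * phi n ^+ 2).
pose bet := series (fun n => Pb n * phi n).
have key : \forall N \near \oo,
    2 * (sig N - Sg) + 4 * (h N * Phi N - E * bet N + (E - h N) * Phi m)
    + 2 * (h N ^+ 2 * rho N - 2 * E * (h N * t N) + E ^+ 2 * W N
           + ((E - h N) * (E - h N) + 2 * (E - h N) * h N) * rho m
           - 2 * E * (E - h N) * t m)
    = 2 * (\sum_(0 <= n < N) q n * (phi n + e N n) ^+ 2) - 2 * Sg.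
  near=> N; have mN : (m <= N)%N by near: N; exact: nbhs_infty_ge.
  have -> : \sum_(0 <= n < N) q n * (phi n + e N n) ^+ 2 =
     \sum_(0 <= n < N) (q n * phi n ^+ 2
       + (2 * h N * phi n - 2 * E * (Pb n * phi n)
          + 2 * (E - h N) * ((n < m)%:R * phi n))
       + (h N ^+ 2 * (q n)^-1 - 2 * E * h N * (Pb n / q n)
          + E ^+ 2 * (Pb n ^+ 2 / q n)
          + ((E - h N) * (E - h N) + 2 * (E - h N) * h N) * ((n < m)%:R * (q n)^-1)
          - 2 * E * (E - h N) * ((n < m)%:R * (Pb n / q n)))).
    apply: eq_bigr => n _; rewrite eE; have := q_gt0 n => q0.
    (* The case split supplies the fact that the indicator equals its square. *)
    by case: (n < m)%N => /=; field; rewrite gt_eqF.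
  rewrite !big_split/= !sumrN -!mulr_sumr !sum_lt_indic// /sig /bet /series/=.
  by ring.
apply: cvg_trans (near_eq_cvg key) _.
(* The limit produces [rho m - 2 * t m], which this turns into [s m - t m]. *)
have sE : s m = rho m - t m.
  rewrite /series/= -sumrB; apply: eq_bigr => n _.
  by have := q_gt0 n => q0; field; rewrite gt_eqF.
have -> : 4 * (- B + Phi m) * E + 2 * (Tp + s m - t m) * E ^+ 2 =
  2 * (Sg - Sg) + 4 * (0 - E * B + (E - 0) * Phi m)
    + 2 * (0 - 2 * E * 0 + E ^+ 2 * Tp
           + ((E - 0) * (E - 0) + 2 * (E - 0) * 0) * rho m
           - 2 * E * (E - 0) * t m) by rewrite sE; ring.
have Eh : E - h N @[N --> \oo] --> E - 0.
  by apply: cvgB; [exact: cvg_cst | exact: flux_cvg0].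
apply: cvgD; first apply: cvgD.
- by apply: cvgMl_tmp; apply: cvgB => //; exact: cvg_cst.
- apply: cvgMl_tmp; apply: cvgD; last exact: cvgMr_tmp.
  by apply: cvgB; [exact: flux_Phi_cvg0 | exact: cvgMl_tmp].
apply: cvgMl_tmp; apply: cvgB; last by apply: cvgMr_tmp; exact: cvgMl_tmp.
apply: cvgD; last first.
  apply: cvgMr_tmp; apply: cvgD; first exact: cvgM.
  by apply: cvgM; [exact: cvgMl_tmp | exact: flux_cvg0].
apply: cvgD; last by apply: cvgMl_tmp; exact: tail_sq_cvg.
apply: cvgB; first exact: flux_sq_rho_cvg0.
by apply: cvgMl_tmp; exact: flux_mean_down_cvg0.
Unshelve. all: by end_near. Qed.

End mixed_scheme_errors.

(** * Explicit mean first-passage quantities *)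

Lemma nneseries_EFin_cvg (R : realType) (u : nat -> R) (m : nat) :
  (forall n, 0 <= u n) -> (\sum_(m <= n <oo) (u n)%:E < +oo)%E ->
  \sum_(m <= n < N) u n @[N --> \oo] --> fine (\sum_(m <= n <oo) (u n)%:E)%E.
Proof.
move=> u0 fin; have fE : (\sum_(m <= n <oo) (u n)%:E)%E \is a fin_num.
  by rewrite ge0_fin_numE//; apply: nneseries_ge0 => n _ _; rewrite lee_fin.
have : (\sum_(m <= n < N) (u n)%:E)%E @[N --> \oo] -->
    (fine (\sum_(m <= n <oo) (u n)%:E)%E)%:E.
  by rewrite fineK//; apply: is_cvg_nneseries => n _ _; rewrite lee_fin.
by under eq_fun do rewrite sumEFin; move/fine_cvg.
Qed.

Section stationary.
Context (R : realType).
Variables lam mu : nat -> R.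
Hypothesis lam_gt0 : forall n, 0 < lam n.
Hypothesis mu0 : mu 0%N = 0.
Hypothesis mu_gt0 : forall n, (1 <= n)%N -> 0 < mu n.
Hypothesis sum_pi_cvg : (\sum_(0 <= n <oo) (pi_weight lam mu n)%:E < +oo)%E.

Local Notation wt := (pi_weight lam mu).
Local Notation p := (steady_prob lam mu).
Local Notation Z := (limn (series wt)).

Let wt_gt0 n : 0 < wt n. Proof. exact: pi_weight_gt0. Qed.

Let wt_cvg : cvgn (series wt).
Proof.
by apply/cvg_ex; eexists; apply: nneseries_EFin_cvg sum_pi_cvg => n; exact: ltW.
Qed.

Lemma pi_mass_gt0 : 0 < Z.
Proof.
apply: (@lt_le_trans _ _ (series wt 1%N)); first by rewrite /series/= big_nat1.
apply: nondecreasing_cvgn_le => //; apply/nondecreasing_seqP => k.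
by rewrite /series/= big_nat_recr//= lerDl ltW.
Qed.

Lemma steady_prob_gt0 n : 0 < p n.
Proof. by apply: divr_gt0 => //; exact: pi_mass_gt0. Qed.

Lemma steady_prob_cvg1 : series p @ \oo --> (1 : R).
Proof.
have -> : series p = (fun N => series wt N * Z^-1).
  by apply/funext => N; rewrite /series/= mulr_suml.
by rewrite -(divff (lt0r_neq0 pi_mass_gt0)); apply: cvgMr_tmp.
Qed.

Lemma detailed_balance n : mu n.+1 * p n.+1 = lam n * p n.
Proof. by rewrite /steady_prob mulrA [RHS]mulrA pi_weightS. Qed.

Lemma steady_flux_gt0 n : 0 < lam n * p n.
Proof. by rewrite mulr_gt0// steady_prob_gt0. Qed.

Let wt_div j x : wt j * (lam x * wt x)^-1 = p j / (lam x * p x).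
Proof.
have := pi_mass_gt0 => Z0; have := wt_gt0 x => wx; have := lam_gt0 x => lx.
by rewrite /steady_prob; field; rewrite !gt_eqF.
Qed.

(** Interchanging the sums for [j < N], with [N >= i], turns the inner sum over [j > x] into
    [F N - F x.+1], which tends to [l - F x.+1]. Working on partial sums allows [f] of any sign. *)
Lemma green_down_series (f : nat -> R) (l : R) (i : nat) :
  series (fun j => f j * p j) @ \oo --> l ->
  (\sum_(0 <= j <oo | j != 0%N)
     (f j)%:E * (wt j * \sum_(0 <= x < i | (x < j)%N) (lam x * wt x)^-1)%:E
   = (\sum_(0 <= x < i) (l - \sum_(0 <= j < x.+1) f j * p j)
        / (lam x * p x))%:E)%E.
Proof.
move=> fl; rewrite eseries_mkcond; apply/cvg_lim => //.
pose F N := \sum_(0 <= j < N) f j * p j.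
have key : \forall N \near \oo,
   (\sum_(0 <= x < i) (F N - F x.+1) / (lam x * p x))%:E =
   (\sum_(0 <= j < N) if j != 0%N then (f j)%:E * (wt j *
     \sum_(0 <= x < i | (x < j)%N) (lam x * wt x)^-1)%:E else 0)%E.
  near=> N; have iN : (i <= N)%N by near: N; exact: nbhs_infty_ge.
  rewrite (eq_bigr (fun j => (\sum_(0 <= x < i)
      (x < j)%:R * (f j * p j) / (lam x * p x))%:E)); last first.
    move=> [|j] _ /=.
      by rewrite big1// => x _; rewrite !mul0r.
    rewrite -EFinM mulr_sumr mulr_sumr big_mkcond/=; congr EFin.
    apply: eq_bigr => x _; rewrite wt_div.
    by case: (x < j.+1)%N; rewrite ?mul0r// mul1r mulrA.
  rewrite sumEFin exchange_big/=; congr EFin; apply: eq_big_nat => x /andP[_ xi].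
  rewrite -mulr_suml; congr (_ / _).
  have xN : (x.+1 <= N)%N by exact: leq_trans xi iN.
  have -> : F N - F x.+1 = \sum_(x.+1 <= j < N) f j * p j.
    by rewrite /F (big_cat_nat (n := x.+1))//= addrAC subrr add0r.
  rewrite [RHS](big_cat_nat (n := x.+1))//= [X in _ = X + _]big_nat_cond.
  rewrite [X in _ = X + _]big1 ?add0r; last first.
    by move=> j /andP[/andP[_ jx] _]; rewrite ltnNge -ltnS jx mul0r.
  by apply: eq_big_nat => j /andP[xj _]; rewrite xj mul1r.
apply: cvg_trans (near_eq_cvg key) _; apply: cvg_EFin; first exact: nearW.
have sE L : \sum_(0 <= x < i) (L - F x.+1) / (lam x * p x) =
    L * (\sum_(0 <= x < i) (lam x * p x)^-1)
    - \sum_(0 <= x < i) F x.+1 / (lam x * p x).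
  by rewrite mulr_sumr -sumrB; apply: eq_bigr => x _; rewrite mulrBl.
rewrite /= sE; under eq_fun do rewrite /= sE.
by apply: cvgB; [exact: cvgMr_tmp | exact: cvg_cst].
Unshelve. all: by end_near. Qed.

Lemma green_up_series (N : nat) :
  (\sum_(0 <= j <oo | j != N)
     (wt j * \sum_(j <= x < N) (lam x * wt x)^-1)%:E
   = (\sum_(0 <= x < N) steady_cdf lam mu x / (lam x * p x))%:E)%E.
Proof.
have pos j : 0 <= wt j * \sum_(j <= x < N) (lam x * wt x)^-1.
  rewrite mulr_ge0 ?(ltW (wt_gt0 j))//; apply: sumr_ge0 => x _.
  by rewrite invr_ge0 ltW// mulr_gt0.
rewrite eseries_mkcond (nneseries_split 0 N); last first.
  by move=> j _; case: ifP => // _; rewrite lee_fin.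
rewrite [X in (_ + X)%E]eseries0 ?adde0 ?add0n; last first.
  by move=> j Nj _; rewrite big_geq// mulr0; case: ifP.
rewrite (eq_big_nat _ _ (F2 := fun j =>
  (\sum_(j <= x < N) p j / (lam x * p x))%:E)); last first.
  move=> j /andP[_ jN]; rewrite ltn_eqF//= mulr_sumr; congr EFin.
  by apply: eq_bigr => x _; rewrite wt_div.
rewrite sumEFin; congr EFin; elim: N {pos} => [|N ih]; first by rewrite !big_geq.
rewrite [RHS]big_nat_recr//= -ih /steady_cdf mulr_suml.
rewrite [in LHS]big_nat_recr//= [X in _ + X = _]big_nat1.
rewrite [X in _ = _ + X]big_nat_recr//= addrA; congr (_ + _).
rewrite -big_split/=; apply: eq_big_nat => j /andP[_ jN].
by rewrite big_nat_recr//= ltnW.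
Qed.

(** * Flux form of the forward, backward and mixed recursions *)

Section recursions.
Variable c : nat -> R.
Local Notation zeta := (mean_cost lam mu c).
Local Notation phi := (marginal_cost lam mu c).

(** Multiplied by [lam n * p n], the recursion telescopes by detailed balance: each step adds
    [(z - c n) * p n]. *)
Lemma forward_recE z n :
  forward_rec lam mu c z n = \sum_(0 <= j < n.+1) (z - c j) * p j / (lam n * p n).
Proof.
rewrite -mulr_suml; elim: n => [|n ih].
  rewrite big_nat1 /=; have := lam_gt0 0; have := steady_prob_gt0 0 => p0 l0.
  by field; rewrite !gt_eqF.
rewrite big_nat_recr//= ih -detailed_balance; set s := \sum_(0 <= j < n.+1) _.
have := mu_gt0 (ltn0Sn n); have := lam_gt0 n.+1; have := steady_prob_gt0 n.+1.
by move=> p0 l0 m0; field; rewrite !gt_eqF.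
Qed.

Lemma forward_rec_error z n : forward_rec lam mu c z n - phi n =
  (z - zeta) * steady_cdf lam mu n / (lam n * p n).
Proof.
rewrite /marginal_cost !forward_recE -!mulr_suml -mulrBl; congr (_ / _).
by rewrite -sumrB mulr_sumr; apply: eq_bigr => j _; ring.
Qed.

(** The exact [phi] obeys the backward recursion with [zeta]; subtracting, the flux error drops by
    [(z - zeta) * p n.+1] from [n.+1] to [n], and the drops sum to a difference of tails. *)
Lemma backward_steps_error z phiN N k : (k <= N)%N ->
  (lam (N - k)%N * p (N - k)%N) *
    (backward_steps lam mu c z phiN N k - phi (N - k)%N) =
  lam N * p N * (phiN - phi N) -
    (z - zeta) * (steady_tail lam mu (N - k)%N - steady_tail lam mu N).
Proof.
elim: k => [|k ih] kN; first by rewrite subn0 /=; ring.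
have := ih (ltnW kN); rewrite /=.
have -> : (N - k)%N = (N - k.+1).+1 by lia.
set n := (N - k.+1)%N; set b := backward_steps _ _ _ _ _ _ _.
have -> : steady_tail lam mu n = steady_tail lam mu n.+1 + p n.+1.
  by rewrite /steady_tail /steady_cdf [in RHS]big_nat_recr//=; ring.
rewrite /marginal_cost /= -/(marginal_cost lam mu c n) => E.
have := mu_gt0 (ltn0Sn n); have := lam_gt0 n.+1 => l0 m0.
rewrite -(detailed_balance n).
suff -> : mu n.+1 * p n.+1 * ((c n.+1 - z) / mu n.+1 + lam n.+1 / mu n.+1 * b
     - phi n) = lam n.+1 * p n.+1 * (b - ((zeta - c n.+1) / lam n.+1
       + mu n.+1 / lam n.+1 * phi n)) - (z - zeta) * p n.+1.
  by rewrite E; ring.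
by field; rewrite !gt_eqF.
Qed.

Lemma steady_cdf_gt0 n : 0 < steady_cdf lam mu n.
Proof.
rewrite /steady_cdf big_nat_recr//= ltr_wpDl ?steady_prob_gt0// sumr_ge0// => j _.
exact/ltW/steady_prob_gt0.
Qed.

Lemma steady_cdf_nondecreasing : nondecreasing_seq (steady_cdf lam mu).
Proof.
apply/nondecreasing_seqP => n.
by rewrite /steady_cdf [leRHS]big_nat_recr//= lerDl ltW// steady_prob_gt0.
Qed.

(** The cdf is nondecreasing, so once the tail falls below it, it stays below; [m] is the first such
    index. *)
Lemma mixed_rec_switch m n :
  steady_tail lam mu m / steady_cdf lam mu m < 1 ->
  (forall n, steady_tail lam mu n / steady_cdf lam mu n < 1 -> (m <= n)%N) ->
  (steady_cdf lam mu n <= steady_tail lam mu n) = (n < m)%N.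
Proof.
have lt1 k : (steady_tail lam mu k / steady_cdf lam mu k < 1) =
    (steady_tail lam mu k < steady_cdf lam mu k).
  by rewrite ltr_pdivrMr ?steady_cdf_gt0// mul1r.
rewrite lt1 => m_ok m_min; apply/idP/idP => [le|nm].
  rewrite ltnNge; apply/negP => mn.
  have := steady_cdf_nondecreasing mn; rewrite leNgt => /negP; apply.
  move: le m_ok; rewrite /steady_tail; lra.
by rewrite leNgt -lt1; apply/negP => /m_min; rewrite leqNgt nm.
Qed.

Lemma mixed_recE z phiN m N n :
  steady_tail lam mu m / steady_cdf lam mu m < 1 ->
  (forall n, steady_tail lam mu n / steady_cdf lam mu n < 1 -> (m <= n)%N) ->
  (n <= N)%N ->
  mixed_rec lam mu c z phiN N n = phi n +
    (if (n < m)%N then (z - zeta) * steady_cdf lam mu n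
     else lam N * p N * (phiN - phi N)
          - (z - zeta) * (steady_tail lam mu n - steady_tail lam mu N))
    / (lam n * p n).
Proof.
move=> m_ok m_min nN; rewrite /mixed_rec (mixed_rec_switch _ m_ok m_min).
case: ifP => _; first by rewrite -forward_rec_error; ring.
have := backward_steps_error z phiN (leq_subr n N); rewrite subKn// => <-.
rewrite mulrAC divff ?mul1r ?(lt0r_neq0 (steady_flux_gt0 n))//.
by rewrite /backward_rec; ring.
Qed.

Hypothesis cost_summable :
  (\sum_(0 <= n <oo) (`|c n| * p n)%:E < +oo)%E.

Lemma cost_part_cvg (f : nat -> R) : (forall n, 0 <= f n <= `|c n|) ->
  cvgn (series (fun n => f n * p n)).
Proof.
move=> fc; have p0 n := ltW (steady_prob_gt0 n).
apply: (@series_le_cvg _ _ (fun n => `|c n| * p n)).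
- by move=> n; have /andP[f0 _] := fc n; rewrite mulr_ge0.
- by move=> n; rewrite mulr_ge0.
- by move=> n; have /andP[_ fn] := fc n; rewrite ler_wpM2r.
- apply/cvg_ex; eexists; apply: nneseries_EFin_cvg cost_summable => n.
  by rewrite mulr_ge0.
Qed.

(** The first sum and the last series are the closed forms obtained below for H_(i0) and T_(i0). *)
Lemma sum_marginal_costE i :
  series phi i = \sum_(0 <= x < i) (zeta - \sum_(0 <= j < x.+1) c j * p j)
      / (lam x * p x)
    - zeta * series (fun x => steady_tail lam mu x / (lam x * p x)) i.
Proof.
rewrite /series/= mulr_sumr -sumrB; apply: eq_bigr => x _.
rewrite /marginal_cost forward_recE -mulr_suml mulrA -mulrBl; congr (_ / _).
have -> : \sum_(0 <= j < x.+1) (zeta - c j) * p j =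
    zeta * steady_cdf lam mu x - \sum_(0 <= j < x.+1) c j * p j.
  by rewrite /steady_cdf mulr_sumr -sumrB; apply: eq_bigr => j _; ring.
by rewrite /steady_tail; ring.
Qed.

End recursions.

(** * Closed forms of the hitting times and costs of the process *)

Section hitting_values.
Context (d : measure_display) (Omega : measurableType d).
Variables (X : R -> Omega -> nat) (Pr : nat -> probability Omega R).
Hypothesis bdX : forall i, is_birth_death_from lam mu i (Pr i) X.
Hypothesis sum_lampi_div :
  (\sum_(0 <= n <oo) ((lam n * wt n)^-1)%:E = +oo)%E.

Let mu_ge0 n : 0 <= mu n. Proof. exact: death_rate_ge0. Qed.

Let green_down i := killed_green_down lam_gt0 mu0 mu_gt0
  (killed_mass_le1 0 (bdX i)) erefl sum_lampi_div.

Lemma mean_hitting_time_down i : mean_hitting_time Pr X i 0 =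
  (series (fun x => steady_tail lam mu x / (lam x * p x)) i)%:E.
Proof.
have [hit1 gE] := green_down i.
rewrite (mean_hitting_timeE lam_gt0 mu_ge0 (bdX i) hit1).
have p1 : series (fun j => (fun=> 1) j * p j) @ \oo --> (1 : R).
  rewrite (_ : (fun j => _) = p); first exact: steady_prob_cvg1.
  by apply/funext => j; rewrite mul1r.
apply: etrans (etrans _ (green_down_series i p1)) _.
  by apply: eq_eseriesr => j j0; rewrite mul1e gE.
congr EFin; apply: eq_bigr => x _; congr (_ / _); congr (1 - _).
by apply: eq_bigr => j _; rewrite mul1r.
Qed.

Lemma mean_hitting_time_up N : mean_hitting_time Pr X 0 N =
  (series (fun x => steady_cdf lam mu x / (lam x * p x)) N)%:E.
Proof.
(* [killed_green_up] takes a positive target; for [N = 0] the start is the target and both sides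
   vanish. *)
case: N => [|N].
  by rewrite mean_hitting_time_down /series/= !big_geq.
have [hit1 gE] := killed_green_up lam_gt0 mu0 mu_gt0
  (killed_mass_le1 N.+1 (bdX 0)) erefl (ltn0Sn N).
rewrite (mean_hitting_timeE lam_gt0 mu_ge0 (bdX 0) hit1).
rewrite -(green_up_series N.+1).
by apply: eq_eseriesr => j j0; rewrite gE.
Qed.

(** Both parts of [c] are dominated by its absolute value, hence summable against [p]; the formula
    is linear in the cost, so the two values recombine. *)
Lemma mean_hitting_cost_down (c : nat -> R) i :
  (\sum_(0 <= n <oo) (`|c n| * p n)%:E < +oo)%E ->
  mean_hitting_cost c Pr X i 0 =
  (\sum_(0 <= x < i) (mean_cost lam mu c - \sum_(0 <= j < x.+1) c j * p j)
      / (lam x * p x))%:E.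
Proof.
move=> csum; have [hit1 gE] := green_down i.
pose cp j := Num.max (c j) 0; pose cn j := Num.max (- c j) 0.
have cvp : cvgn (series (fun n => cp n * p n)).
  apply: (cost_part_cvg csum) => n; rewrite /cp le_max lexx orbT ge_max normr_ge0.
  by rewrite andbT ler_norm.
have cvn : cvgn (series (fun n => cn n * p n)).
  apply: (cost_part_cvg csum) => n; rewrite /cn le_max lexx orbT ge_max normr_ge0.
  by rewrite andbT -normrN ler_norm.
have cE j : c j = cp j - cn j.
  by rewrite /cp /cn; case: (leP (c j) 0); case: (leP (- c j) 0) => ? ?; lra.
have zetaE : mean_cost lam mu c = limn (series (fun n => cp n * p n))
    - limn (series (fun n => cn n * p n)).
  rewrite /mean_cost; apply: cvg_lim => //.
  have -> : series (fun n => c n * p n) = (fun N => series (fun n => cp n * p n) N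
      - series (fun n => cn n * p n) N).
    apply/funext => N; rewrite /series/= -sumrB; apply: eq_bigr => j _.
    by rewrite {1}cE mulrBl.
  exact: cvgB.
have gsum (f : nat -> R) : cvgn (series (fun n => f n * p n)) ->
    (\sum_(0 <= j <oo | j != 0%N) (f j)%:E *
      \sum_(0 <= k <oo) (killed_prob lam mu 0 i k j / exit_rate lam mu j)%:E =
    (\sum_(0 <= x < i) (limn (series (fun n => f n * p n))
       - \sum_(0 <= j < x.+1) f j * p j) / (lam x * p x))%:E)%E.
  by move=> fcv; rewrite -green_down_series//; apply: eq_eseriesr => j j0; rewrite gE.
rewrite (mean_hitting_costE lam_gt0 mu_ge0 (bdX i) hit1 (gsum cp cvp) (gsum cn cvn)).
congr EFin; rewrite -sumrB; apply: eq_bigr => x _; rewrite -mulrBl zetaE.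
have -> : \sum_(0 <= j < x.+1) c j * p j =
    \sum_(0 <= j < x.+1) cp j * p j - \sum_(0 <= j < x.+1) cn j * p j.
  by rewrite -sumrB; apply: eq_bigr => j _; rewrite {1}cE mulrBl.
by congr (_ / _); ring.
Qed.

End hitting_values.

End stationary.

(** * Assembly of the two limits *)

Unset Implicit Arguments.

Theorem proposition7p3 (R : realType) (d : measure_display)
  (Omega : measurableType d) (lam mu c : nat -> R)
  (Pr : nat -> probability Omega R) (X : R -> Omega -> nat)
  (lam_gt0 : forall n, 0 < lam n)
  (mu0 : mu 0%N = 0)
  (mu_gt0 : forall n, (1 <= n)%N -> 0 < mu n)
  (bdX : forall i, is_birth_death_from lam mu i (Pr i) X)
  (sum_lampi_div :
     (\sum_(0 <= n <oo) ((lam n * pi_weight lam mu n)^-1)%:E = +oo)%E)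
  (sum_pi_cvg : (\sum_(0 <= n <oo) (pi_weight lam mu n)%:E < +oo)%E)
  (cost_summable :
     (\sum_(0 <= n <oo) (`|c n| * steady_prob lam mu n)%:E < +oo)%E)
  (m : nat)
  (m_ok : steady_tail lam mu m / steady_cdf lam mu m < 1)
  (m_min : forall n, steady_tail lam mu n / steady_cdf lam mu n < 1 ->
     (m <= n)%N)
  (zhat : R) (phiN : nat -> R)
  (zhat_neq : zhat != mean_cost lam mu c)
  (beta0_cvg : cvgn (series (beta0_term lam mu c)))
  (sigma2_cvg : cvgn (series (sigma2_term lam mu c)))
  (Tp0_fin :
     (mean_hitting_time_steady (steady_prob lam mu) Pr X 0 < +oo)%E) :
  let p := steady_prob lam mu in
  (* every expectation passed to [fine] is finite under the hypotheses *)
  let T i j := fine (mean_hitting_time Pr X i j) in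
  let H i j := fine (mean_hitting_cost c Pr X i j) in
  let Tp0 := fine (mean_hitting_time_steady p Pr X 0) in
  let Ephi N := abs_error (phiN N) (marginal_cost lam mu c N) in
  let Ezeta := abs_error zhat (mean_cost lam mu c) in
  let Ebeta0 N :=
    abs_error (beta0_mixed lam mu c zhat (phiN N) N) (beta lam mu c 0) in
  let Esigma2 N :=
    abs_error (sigma2_mixed lam mu c zhat (phiN N) N) (sigma2 lam mu c) in
  (lam N * p N * T N 0%N * Ephi N @[N --> \oo] --> 0 ->
     Ebeta0 N @[N --> \oo] --> (Tp0 - T m 0%N) * Ezeta)
  /\
  (lam N * p N * T N 0%N * Ephi N @[N --> \oo] --> 0 ->
   lam N * p N * H N 0%N * Ephi N @[N --> \oo] --> 0 ->
   lam N * p N * Num.sqrt (T 0%N N) * Ephi N @[N --> \oo] --> 0 ->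
     Esigma2 N @[N --> \oo] -->
       4 * beta lam mu c m * Ezeta
       + 2 * (Tp0 + T 0%N m - T m 0%N) * Ezeta ^+ 2).
Proof.
move=> p T H Tp0 Ephi Ezeta Ebeta0 Esigma2.
pose q n := lam n * p n; pose phi := marginal_cost lam mu c.
pose P n := \sum_(0 <= j < n.+1) p j.
pose t := series (fun n => (1 - P n) / q n).
have p_gt0 n : 0 < p n by exact: steady_prob_gt0.
have q_gt0 n : 0 < q n by exact: steady_flux_gt0.
have p_cvg : series p @ \oo --> (1 : R) by exact: steady_prob_cvg1.
have TdE i : T i 0%N = t i.
  by rewrite /T (mean_hitting_time_down lam_gt0 mu0 mu_gt0 sum_pi_cvg bdX sum_lampi_div).
have TuE N : T 0%N N = series (fun n => P n / q n) N.
  by rewrite /T (mean_hitting_time_up lam_gt0 mu0 mu_gt0 sum_pi_cvg bdX sum_lampi_div).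
have HE i : H i 0%N = series phi i + mean_cost lam mu c * t i.
  rewrite /H (mean_hitting_cost_down lam_gt0 mu0 mu_gt0 sum_pi_cvg bdX sum_lampi_div)//=.
  rewrite (sum_marginal_costE lam_gt0 mu_gt0 sum_pi_cvg).
  by rewrite /t /series/= subrK.
have t_ge0 i : 0 <= t i by exact: mean_down_ge0.
have Tp_cvg : \sum_(1 <= i < N) p i * t i @[N --> \oo] --> Tp0.
  have TpE : mean_hitting_time_steady p Pr X 0 = (\sum_(1 <= i <oo) (p i * t i)%:E)%E.
    apply: eq_eseriesr => i _.
    by rewrite (mean_hitting_time_down lam_gt0 mu0 mu_gt0 sum_pi_cvg bdX sum_lampi_div).
  rewrite /Tp0 TpE; apply: nneseries_EFin_cvg => [i|]; last by rewrite -TpE.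
  by rewrite mulr_ge0// ltW.
(* The flux error at the terminal index; with it, [e] has the form required by the two limit
   lemmas. *)
pose a N := q N * Ephi N.
pose e N n := (if (n < m)%N then Ezeta * P n
  else a N - Ezeta * ((1 - P n) - (1 - P N))) / q n.
have mixE N n : (n < N)%N -> mixed_rec lam mu c zhat (phiN N) N n = phi n + e N n.
  by move=> nN; apply: mixed_recE => //; exact: ltnW.
have bE : Ebeta0 = (fun N => - \sum_(0 <= n < N) (1 - P n) * (phi n + e N n)
    + limn (series (beta0_term lam mu c))).
  apply/funext => N; rewrite /Ebeta0 /abs_error /beta0_mixed /beta [X in _ - (_ + X)]big_geq// addr0 opprK.
  by congr (- _ + _); apply: eq_big_nat => n /andP[_ nN]; rewrite mixE.
have sE : Esigma2 = (fun N => 2 * (\sum_(0 <= n < N) q n * (phi n + e N n) ^+ 2)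
    - 2 * limn (series (sigma2_term lam mu c))).
  apply/funext => N; rewrite /Esigma2 /abs_error /sigma2_mixed /sigma2.
  by congr (_ * _ - _); apply: eq_big_nat => n /andP[_ nN]; rewrite mixE.
have aT x : (fun N => lam N * p N * x N * Ephi N) = (fun N => a N * x N).
  by apply/funext => N; rewrite /a /q; ring.
rewrite TdE TuE; split; rewrite !aT.
  under eq_fun do rewrite TdE; move=> at0.
  rewrite bE.
  exact: (beta0_mixed_error_cvg p_gt0 q_gt0 p_cvg beta0_cvg Tp_cvg at0).
under eq_fun do rewrite TdE; move=> at0.
under eq_fun do rewrite HE; move=> aH0.
under eq_fun do rewrite TuE; move=> as0.
rewrite sE.
apply: (sigma2_mixed_error_cvg p_gt0 q_gt0 p_cvg beta0_cvg sigma2_cvg Tp_cvg at0 _ as0) => //.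
(* [series phi] is H minus zeta times T, so its product with [a] splits into two quantities assumed
   to vanish. *)
rewrite (_ : (fun N => _) = (fun N => a N * (series phi N + mean_cost lam mu c * t N)
  - mean_cost lam mu c * (a N * t N))); last first.
  by apply/funext => N; ring.
rewrite -[X in _ --> X](subr0 0); apply: cvgB => //.
by rewrite -[X in _ --> X](mulr0 (mean_cost lam mu c)); apply: cvgMl_tmp.
Qed.
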